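(* Let $k\geq 2$ be an integer and let $f=f(x)=x^k+c\in\mathbb{Q}(c)[x]$, where $c$ is an indeterminate. Let $M,N$ be positive integers. Then there exist infinitely many $M$-tuples of integers $(m_1,\ldots,m_M)\in\mathbb{Z}^M$ such that $$\operatorname{Gal}\left(\left(\prod_{i=1}^M K_{f+m_i,N}\right)\Big/\overline{\mathbb{Q}}(c)\right)\simeq\prod_{i=1}^M\operatorname{Gal}\left(K_{f+m_i,N}\big/\overline{\mathbb{Q}}(c)\right).$$
   Context: For a polynomial $g\in\mathbb{Q}(c)[x]$ and a positive integer $n$, $g^n$ denotes the $n$-fold composition of $g$ with itself (in the variable $x$), and $K_{g,n}$ denotes the splitting field of $g^n(x)-x$ over $\overline{\mathbb{Q}}(c)$. Here $f+m_i$ is the polynomial $x^k+(c+m_i)$. The field $\prod_{i=1}^M K_{f+m_i,N}$ denotes the splitting field over $\overline{\mathbb{Q}}(c)$ of $\prod_{i=1}^M\left((f+m_i)^N(x)-x\right)$, i.e. the compositum of the fields $K_{f+m_i,N}$ inside a fixed algebraic closure. The product of groups on the right is the direct product. *)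

(* Defs.v *)
From HB Require Import structures.
From mathcomp Require Import all_boot all_order all_algebra.
From mathcomp Require Import all_fingroup all_solvable all_field.
From mathcomp Require Import boolp classical_sets cardinality.

Set Implicit Arguments.
Unset Strict Implicit.
Unset Printing Implicit Defensive.

Import GRing.Theory.
Local Open Scope ring_scope.

(* [algC] is an algebraic closure of the rationals, so this is the field of
   rational functions over it in the indeterminate [cvar]. *)
Definition Qbar_c : fieldType := {fraction {poly algC}}.

Definition cvar : Qbar_c := tofrac ('X : {poly algC}).

(* x^k + (c + m), viewed in Qbar(c)[x]. *)
Definition shifted_unicritical (k : nat) (m : int) : {poly Qbar_c} :=
  'X^k + (cvar + m%:~R)%:P.

Definition poly_iterate (F : fieldType) (g : {poly F}) (n : nat) : {poly F} :=
  iter n (fun h => g \Po h) 'X.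

Definition periodic_poly (F : fieldType) (g : {poly F}) (n : nat) : {poly F} :=
  poly_iterate g n - 'X.

Definition is_splitting_field (F : fieldType) (L : fieldExtType F)
    (p : {poly F}) (E : {subfield L}) : Prop :=
  splittingFieldFor 1 (map_poly (in_alg L) p) E.

(* Splitting fields exist only up to isomorphism, so the fields [K i] and [E]
   range over all splitting fields inside an arbitrary ambient extension [L];
   [splitting_fields_exist] below shows that such fields do exist. *)
Definition gal_is_direct_product (k M N : nat) (m : M.-tuple int) : Prop :=
  let p i := periodic_poly (shifted_unicritical k (tnth m i)) N in
  forall (L : splittingFieldType Qbar_c)
         (K : 'I_M -> {subfield L}) (E : {subfield L}),
    (forall i, is_splitting_field (p i) (K i)) ->
    is_splitting_field (\prod_i p i) E ->
    ('Gal(E / 1) \isog setXn (fun i => 'Gal(K i / 1)))%g.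

Lemma irreducible_divisor (F : fieldType) (p : {poly F}) :
  (1 < size p)%N -> exists2 r : {poly F}, r %| p & irreducible_poly r.
Proof.
move: {2}(size p).+1 (ltnSn (size p)) => n.
elim: n p => // n IHn p lepn p_gt1.
have [irr_p|nirr_p] := pselect (irreducible_poly p); first by exists p.
have [q] : exists q : {poly F}, [/\ size q != 1%N, q %| p & ~~ (q %= p)].
  apply: contrapT => nq; apply: nirr_p; split=> // q q1 qp.
  by apply: contrapT => /negP nqp; apply: nq; exists q.
case=> q1 qp nqp.
have p0 : p != 0 by rewrite -size_poly_gt0 ltnW.
have q0 : q != 0 by apply: dvdpN0 qp p0.
have q_gt1 : (1 < size q)%N by rewrite ltn_neqAle eq_sym q1 size_poly_gt0.
have ltqp : (size q < size p)%N.
  by rewrite ltn_neqAle dvdp_leq // andbT dvdp_size_eqp.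
have [r rq irr_r] := IHn q (leq_trans ltqp lepn) q_gt1.
by exists r => //; apply: dvdp_trans rq qp.
Qed.

Lemma splitting_ext_exists (F : fieldType) (p : {poly F}) : p != 0 ->
  exists (L : fieldExtType F) (zs : seq L),
    map_poly (in_alg L) p %= \prod_(z <- zs) ('X - z%:P).
Proof.
have mapXsubC (R S : nzRingType) (f : {rmorphism R -> S}) x :
    map_poly f ('X - x%:P) = 'X - (f x)%:P.
  by rewrite rmorphB /= map_polyX map_polyC.
move: {2}_.+1 (ltnSn (size p)) => n; elim: n => // n IHn in F p * => lbn nz_p.
have [Cp|C'p] := leqP (size p) 1.
  exists F^o, [::].
  by rewrite big_nil -size_poly_eq1 size_map_poly eqn_leq Cp size_poly_gt0.
have [r r_dv_p irr_r] := irreducible_divisor C'p.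
have{irr_r} [K _ [x rx0 defK]] := irredp_FAdjoin irr_r.
have{r rx0 r_dv_p} /factor_theorem/sig_eqW[q Dp] : root (map_poly (in_alg K) p) x.
  by rewrite -(divpK r_dv_p) rmorphM rootM rx0 orbT.
have Dszp : size p = size (q * ('X - x%:P)) by rewrite -Dp size_map_poly.
have nz_q : q != 0.
  by move: nz_p; rewrite -size_poly_eq0 Dszp size_poly_eq0 mulf_eq0 => /norP[].
have [||L [zs Dq]] := IHn K q => //.
  by rewrite ltnS Dszp size_mul ?polyXsubC_eq0 ?size_XsubC ?addn2 in lbn.
suffices: exists zs : seq L, map_poly (in_alg L) (map_poly (in_alg K) p)
    %= \prod_(z <- zs) ('X - z%:P).
  rewrite -[map_poly _ (map_poly _ _)]map_poly_comp.
  rewrite -(eq_map_poly (fun a : F => baseField_scaleE a 1)).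
  by exists (baseFieldType L).
exists (x%:A :: zs); rewrite big_cons; set rhs := _ * _.
by rewrite Dp mulrC rmorphM /= mapXsubC /= eqp_mull.
Qed.

Lemma splitting_field_exists (F : fieldType) (p : {poly F}) : p != 0 ->
  exists L : splittingFieldType F, is_splitting_field p {:L}%AS.
Proof.
have mapXsubC (R S : nzRingType) (f : {rmorphism R -> S}) x :
    map_poly f ('X - x%:P) = 'X - (f x)%:P.
  by rewrite rmorphB /= map_polyX map_polyC.
move=> /splitting_ext_exists[L [ys Dp]].
pose Lp := subvs_of <<1 & ys>>; pose toL := linfun (vsval : Lp -> L).
have [zs Dys] : {zs | map toL zs = ys}.
  exists (map (vsproj _) ys); rewrite -map_comp map_id_in // => y ys_y.
  by rewrite /= lfunE /= vsprojK ?seqv_sub_adjoin.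
have splitLp : splittingFieldFor 1 (map_poly (in_alg Lp) p) {:Lp}.
  exists zs.
    set lhs := (lhs in lhs %= _); set rhs := (rhs in _ %= rhs).
    suffices: map_poly toL lhs %= map_poly toL rhs by rewrite eqp_map.
    rewrite -Dys big_map in Dp; apply: etrans Dp; apply: congr2.
      by rewrite -map_poly_comp; apply/eq_map_poly=> x; apply: rmorph_alg.
    by rewrite rmorph_prod; apply/eq_bigr=> z _; apply: mapXsubC.
  set Lzs := LHS; pose Lys := (toL @: Lzs)%VS; apply/vspaceP=> u.
  have: val u \in Lys by rewrite /Lys aimg_adjoin_seq aimg1 Dys (valP u).
  by case/memv_imgP=> v Lzs_v; rewrite memvf lfunE => /val_inj->.
have axLp : splitting_field_axiom Lp.
  by exists (map_poly (in_alg Lp) p) => //; apply: alg_polyOver.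
pose S := FieldExt_isSplittingField.Build F Lp axLp.
by exists (HB.pack_for (splittingFieldType F) Lp S).
Qed.

Lemma periodic_poly_neq0 (k : nat) (m : int) (n : nat) :
  (1 < k)%N -> (0 < n)%N -> periodic_poly (shifted_unicritical k m) n != 0.
Proof.
move=> k_gt1 n_gt0; set g := shifted_unicritical k m.
have szg : size g = k.+1.
  rewrite /g /shifted_unicritical size_polyDl size_polyXn // ltnS.
  by rewrite (leq_trans (size_polyC_leq1 _)) // ltnW.
have szi j : (size (poly_iterate g j)).-1 = (k ^ j)%N.
  elim: j => [|j IHj]; first by rewrite /poly_iterate /= size_polyX expn0.
  rewrite expnS -IHj [poly_iterate g j.+1]/(g \Po poly_iterate g j).
  by rewrite size_comp_poly szg.
apply/eqP => /subr0_eq E; have := szi n; rewrite E size_polyX /= => k_n.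
by have := ltn_exp2l 0 n k_gt1; rewrite expn0 -k_n n_gt0.
Qed.

Lemma splitting_fields_exist (k M N : nat) (m : M.-tuple int) :
  (1 < k)%N -> (0 < N)%N ->
  let p i := periodic_poly (shifted_unicritical k (tnth m i)) N in
  exists (L : splittingFieldType Qbar_c)
         (K : 'I_M -> {subfield L}) (E : {subfield L}),
    (forall i, is_splitting_field (p i) (K i)) /\
    is_splitting_field (\prod_i p i) E.
Proof.
move=> k_gt1 N_gt0 p.
have nz_p : \prod_i p i != 0.
  by apply/prodf_neq0 => i _; apply: periodic_poly_neq0.
have [L splitL] := splitting_field_exists nz_p.
have splitp i : exists zs : seq L,
    map_poly (in_alg L) (p i) %= \prod_(z <- zs) ('X - z%:P).
  have [rs Drs _] := splitL.
  have /dvdp_prod_XsubC[ms Dms] :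
      map_poly (in_alg L) (p i) %| \prod_(z <- rs) ('X - z%:P).
    by rewrite -(eqp_dvdr _ Drs) dvdp_map (bigD1 i) //= dvdp_mulr.
  by exists (mask ms rs).
have [zs Dzs] := choice splitp.
exists L, (fun i => <<1 & zs i>>%AS), {:L}%AS; split=> // i.
by exists (zs i).
Qed.

(* Main.v *)
From HB Require Import structures.
Require Import Defs.
From mathcomp Require Import all_boot all_order all_algebra.
From mathcomp Require Import boolp classical_sets cardinality.
From mathcomp Require Import all_fingroup all_field.
From mathcomp Require Import ring zify.

(** Write P_m for f_m^N(x) - x, where f_m = x^k + c + m, and K_m for its
    splitting field over C(c), with C the field of constants. There is a Bezout
    identity u P_0 + v P_0' = d(c) with d a nonzero polynomial: at c = 0 the
    polynomial P_0 is x^(k^N) - x, which has simple roots ([per_poly_bezout]).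
    Translating c, the field K_m is unramified over every finite point that is not
    a zero of d(c + m). The translates of d are pairwise coprime as soon as the
    m_i are far apart ([coprime_translates]), and then K_(m_i) meets the
    compositum of the other K_(m_j) in a field unramified over the whole affine
    line. Such a field is C(c), because the affine line is simply connected in
    characteristic zero; so any automorphism of one K_(m_i) lifts to the compositum
    as an automorphism that is trivial on all the others, which gives the direct
    product ([isog_gal_setXn]).

    Simple connectedness is proved with the derivation D = d/dc, extended to the
    ambient field. Let z be integral over C[c] in a field unramified over the affine
    line. Then D z is integral again, and its growth at infinity is smaller than
    that of z by a factor c. An integral element bounded at infinity is constant,
    since the symmetric functions of its conjugates are polynomials in c without
    pole at infinity ([bounded_integral_constant]). So some iterated derivative of
    z is constant, and z is a polynomial in c by integrating back
    ([integral_asymp_poly]).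

    Neither places nor integral closures are computed. At finite distance the ring
    generated by c, the roots of P_m and 1/d(c + m) is stable under D, by
    differentiating P_m(x) = 0 and inverting P_m'(x) with the Bezout identity
    ([periodic_gen_der]); its elements are integral over C[c] up to a power of
    d(c + m) ([generated_integral]). An element that lies in two such rings with
    coprime denominators is integral over C[c]. At infinity, a periodic point x
    grows like c^(1/k), because x^k = f(x) - c - m and f(x) is again a periodic
    point. Counting c with weight k and periodic points with weight 1 gives a
    filtration that bounds the growth ([weight_asymp], [periodic_asymp]) and whose
    weights D lowers by k ([weight_der], [periodic_weight_der]). *)

Set Implicit Arguments.
Unset Strict Implicit.
Unset Printing Implicit Defensive.

Import Order.TTheory GRing.Theory Num.Theory.
Local Open Scope ring_scope.

(** * Derivations *)

Definition derivation (R : comNzRingType) (d : R -> R) :=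
  {morph d : x y / x + y} /\ forall x y, d (x * y) = d x * y + x * d y.

Section DerivationTheory.

Variables (R : comNzRingType) (d : R -> R).
Hypothesis der_d : derivation d.

Lemma derivationD x y : d (x + y) = d x + d y. Proof. by case: der_d. Qed.

Lemma derivationM x y : d (x * y) = d x * y + x * d y.
Proof. by case: der_d. Qed.

Lemma derivation0 : d 0 = 0.
Proof. by apply: (@addrI _ (d 0)); rewrite -derivationD !addr0. Qed.

Lemma derivation1 : d 1 = 0.
Proof.
by apply: (@addrI _ (d 1)); rewrite -[in RHS](mulr1 1) derivationM mulr1 mul1r addr0.
Qed.

Lemma derivationN x : d (- x) = - d x.
Proof. by apply: (@addrI _ (d x)); rewrite -derivationD !subrr derivation0. Qed.

Lemma derivationB x y : d (x - y) = d x - d y.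
Proof. by rewrite derivationD derivationN. Qed.

Lemma derivationX x n : d (x ^+ n) = x ^+ n.-1 * d x *+ n.
Proof.
elim: n => [|n IHn]; first by rewrite expr0 derivation1 mulr0n.
rewrite exprS derivationM IHn -mulrnAr mulrA [d x * _]mulrC.
case: n {IHn} => [|n] /=; first by rewrite !mulr0n !mulr0 addr0.
by rewrite -exprS -mulrnAr -mulrDr -mulrS.
Qed.

End DerivationTheory.

Lemma derivationV (K : fieldType) (d : K -> K) x :
  derivation d -> d x^-1 = - x ^- 2 * d x.
Proof.
move=> der_d; have [->|nz_x] := eqVneq x 0.
  by rewrite invr0 (derivation0 der_d) mulr0.
have := derivationM der_d x x^-1; rewrite divff // (derivation1 der_d) => E.
by apply: (mulfI nz_x); apply: (addrI (d x / x)); rewrite -E; field.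
Qed.

Lemma derivation_horner (R S : comNzRingType) (i : {rmorphism R -> S})
    (dR : R -> R) (d : S -> S) (p : {poly R}) x :
  derivation dR -> derivation d -> (forall a, d (i a) = i (dR a)) ->
  d (map_poly i p).[x] =
    (map_poly i (map_poly dR p)).[x] + (map_poly i p)^`().[x] * d x.
Proof.
move=> derR der_d di.
have dR0 := derivation0 derR; have d0 := derivation0 der_d.
elim/poly_ind: p => [|p a IHp].
  by rewrite !map_poly0 deriv0 !horner0 mul0r addr0 d0.
have -> : map_poly dR (p * 'X + a%:P) = map_poly dR p * 'X + (dR a)%:P.
  apply/polyP => -[|j]; rewrite coef_map_id0 // !coefD !coefMX !coefC /=.
    by rewrite derivationD // dR0.
  by rewrite !addr0 coef_map_id0.
rewrite !rmorphD !rmorphM /= !map_polyX !map_polyC /= derivD derivM derivX derivC.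
rewrite !hornerE (derivationD der_d) (derivationM der_d) di IHp; ring.
Qed.

Lemma fracP (R : idomainType) (x : {fraction R}) :
  exists2 ab : R * R, ab.2 != 0 & x = tofrac ab.1 / tofrac ab.2.
Proof.
elim/quotW: x => x; exists (\n_x, \d_x); first exact: denom_ratioP.
have nz : tofrac \d_x != 0 :> {fraction R} by rewrite tofrac_eq0 denom_ratioP.
apply: (mulIf nz); rewrite divfK //=.
apply/eqP; unlock FracField.tofrac; rewrite -[X in X == _]FracField.pi_mul.
rewrite eqmodE /= FracField.equivfE /FracField.mulf.
by rewrite !numden_Ratio ?mulr1 ?denom_ratioP ?oner_neq0 // mulrC.
Qed.

Lemma quotient_ruleD (K : fieldType) (a b u v a' b' u' v' : K) :
  b != 0 -> v != 0 ->
  ((a' * v + a * v' + (u' * b + u * b')) * (b * v)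
     - (a * v + u * b) * (b' * v + b * v')) / (b * v) ^+ 2
  = (a' * b - a * b') / b ^+ 2 + (u' * v - u * v') / v ^+ 2.
Proof. by move=> nzb nzv; field; rewrite ?nzb ?nzv. Qed.

Lemma quotient_ruleM (K : fieldType) (a b u v a' b' u' v' : K) :
  b != 0 -> v != 0 ->
  ((a' * u + a * u') * (b * v) - (a * u) * (b' * v + b * v')) / (b * v) ^+ 2
  = (a' * b - a * b') / b ^+ 2 * (u / v) + a / b * ((u' * v - u * v') / v ^+ 2).
Proof. by move=> nzb nzv; field; rewrite ?nzb ?nzv. Qed.

(** The quotient rule does not depend on the fraction a/b chosen: differentiating
    u b = a v compares the two values. *)
Lemma derivation_frac (R : idomainType) (d : R -> R) :
  derivation d ->
  exists2 dF : {fraction R} -> {fraction R},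
    derivation dF & forall a, dF (tofrac a) = tofrac (d a).
Proof.
move=> der_d; pose rep (x : {fraction R}) := s2val (cid2 (fracP x)).
have rep_nz x : tofrac (rep x).2 != 0 :> {fraction R}.
  by rewrite tofrac_eq0; exact: (s2valP (cid2 (fracP x))).
have repE x : x = tofrac (rep x).1 / tofrac (rep x).2 := s2valP' (cid2 (fracP x)).
pose dF x : {fraction R} := let: (a, b) := rep x in
  tofrac (d a * b - a * d b) / tofrac b ^+ 2.
have dF_frac a b : b != 0 -> dF (tofrac a / tofrac b)
    = tofrac (d a * b - a * d b) / tofrac b ^+ 2.
  move=> nz_b; rewrite /dF; set x := _ / _.
  have := repE x; have := rep_nz x; case: (rep x) => u v /= nz_v Dx.
  have nzb : tofrac b != 0 :> {fraction R} by rewrite tofrac_eq0.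
  have eq_uv : u * b = a * v.
    apply/eqP; rewrite -tofrac_eq !tofracM; apply/eqP.
    by move: Dx; rewrite /x => /eqP; rewrite eqr_div // => /eqP->.
  have d_uv : d u * b + u * d b = d a * v + a * d v.
    by rewrite -!(derivationM der_d) eq_uv.
  apply/eqP; rewrite eqr_div ?expf_neq0 // -!tofracXn -!tofracM tofrac_eq.
  apply/eqP.
  have -> : (d u * v - u * d v) * b ^+ 2 =
    v * b * (d u * b + u * d b) - v * d b * (u * b) - d v * b * (u * b) by ring.
  rewrite d_uv eq_uv; ring.
have tofrac1E a : tofrac a = tofrac a / tofrac 1 :> {fraction R}.
  by rewrite tofrac1 divr1.
exists dF => [|a]; last first.
  by rewrite [in LHS]tofrac1E dF_frac ?oner_neq0 // (derivation1 der_d) mulr0 subr0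
             mulr1 tofrac1 expr1n divr1.
split=> x y; case: (fracP x) (fracP y) => [[a b] /= nzb ->] [[u v] /= nzv ->].
  have [nzb1 nzv1] : tofrac b != 0 :> {fraction R} /\ tofrac v != 0 :> {fraction R}.
    by rewrite !tofrac_eq0.
  rewrite addf_div // -!tofracM -tofracD !dF_frac ?mulf_neq0 //.
  rewrite (derivationD der_d) !(derivationM der_d).
  rewrite !tofracB !(tofracD, tofracM); exact: quotient_ruleD.
have [nzb1 nzv1] : tofrac b != 0 :> {fraction R} /\ tofrac v != 0 :> {fraction R}.
  by rewrite !tofrac_eq0.
rewrite mulf_div -!tofracM !dF_frac ?mulf_neq0 //.
rewrite !(derivationM der_d).
rewrite !tofracB !(tofracD, tofracM); exact: quotient_ruleM.
Qed.

Lemma derivation_map_poly (R : comNzRingType) (d : R -> R) :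
  derivation d -> derivation (map_poly d).
Proof.
move=> der_d; have d0 := derivation0 der_d.
split=> p q; apply/polyP=> i.
  by rewrite coefD !coef_map_id0 // coefD (derivationD der_d).
rewrite coefD !coefM !coef_map_id0 // coefM.
rewrite (big_morph _ (derivationD der_d) d0) -big_split; apply: eq_bigr => j _ /=.
by rewrite !coef_map_id0 // (derivationM der_d).
Qed.

(** A derivation of a field of characteristic zero extends to a finite extension
    generated by w with minimal polynomial P: the value at w is forced by
    differentiating P(w) = 0, and separability makes P'(w) invertible. *)
Lemma derivation_ext (F : fieldType) (L : fieldExtType F) (d : F -> F) :
  [pchar L] =i pred0 -> derivation d ->
  exists2 D : L -> L, derivation D & forall a, D a%:A = (d a)%:A.
Proof.
move=> charL0 der_d; have d0 := derivation0 der_d.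
have sepL : separable 1 {:L}.
  by apply/separableP => y _; apply: pcharf0_separable.
pose w := separable_generator 1 {:L}.
have defL : {:L}%VS = <<1; w>>%VS := eq_adjoin_separable_generator sepL (sub1v _).
have sepw : separable_element 1 w := separable_generatorP _ _.
have /polyOver1P[P DP] := minPolyOver 1 w.
pose ev (g : {poly F}) := (map_poly (in_alg L) g).[w].
have evD g h : ev (g + h) = ev g + ev h by rewrite /ev rmorphD hornerD.
have evM g h : ev (g * h) = ev g * ev h by rewrite /ev rmorphM hornerM.
have evP : ev P = 0 by rewrite /ev -DP minPolyxx.
have nzdP : ev P^`() != 0.
  move: sepw; rewrite /separable_element separable_poly.unlock DP => copP.
  apply/negP => dP0; move/coprimep_root: copP => /(_ w).
  by rewrite deriv_map /root -/(ev P) -/(ev P^`()) evP eqxx => /(_ isT)/negP[].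
pose dl := - ev (map_poly d P) / ev P^`().
have [mD mM] := derivation_map_poly der_d.
pose E g := ev (map_poly d g) + ev g^`() * dl.
have ED g h : E (g + h) = E g + E h.
  by rewrite /E mD derivD !evD; ring.
have EM g h : E (g * h) = E g * ev h + ev g * E h.
  by rewrite /E mM derivM !evD !evM; ring.
have EP : E P = 0 by rewrite /E /dl mulrC divfK // subrr.
have E0 g : ev g = 0 -> E g = 0.
  move=> g0; have : minPoly 1 w %| map_poly (in_alg L) g.
    apply: minPoly_dvdp; last by apply/rootP.
    by apply/polyOver1P; exists g.
  rewrite DP dvdp_map => /dvdpP[h ->].
  by rewrite EM evP EP !mulr0 addr0.
have evN g : ev (- g) = - ev g by rewrite /ev rmorphN hornerN.
have EN g : E (- g) = - E g.
  by rewrite /E (derivationN (derivation_map_poly der_d)) derivN !evN; ring.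
have Eeq g h : ev g = ev h -> E g = E h.
  by move=> eq_gh; apply/subr0_eq; rewrite -EN -ED E0 // evD evN eq_gh subrr.
have /choice[q qE] z : exists g, z = ev g.
  by apply/Fadjoin1_polyP; rewrite -defL memvf.
exists (E \o q) => [|a /=].
  split=> x y /=; first by rewrite -ED; apply: Eeq; rewrite evD -!qE.
  transitivity (E (q x * q y)); last by rewrite EM -!qE.
  by apply: Eeq; rewrite evM -!qE.
have evC b : ev b%:P = b%:A by rewrite /ev map_polyC hornerC.
rewrite -(evC (d a)) (Eeq _ a%:P); last by rewrite -qE evC.
rewrite /E derivC {2}/ev map_poly0 horner0 mul0r addr0; congr ev.
by apply/polyP=> i; rewrite coef_map_id0 // !coefC; case: eqP.
Qed.

(** * Polynomials in one transcendental *)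

Section Transcendental.

Variables (C : numClosedFieldType) (L : fieldType).
Variable io : {rmorphism {poly C} -> L}.
Hypothesis io_inj : injective io.

Local Notation c := (io 'X).

Definition scalar_emb : C -> L := io \o polyC.
HB.instance Definition _ := GRing.RMorphism.on scalar_emb.

Lemma io_eq0 p : (io p == 0) = (p == 0).
Proof. by rewrite -(rmorph0 io) (inj_eq io_inj). Qed.

Lemma io_X_neq0 : c != 0. Proof. by rewrite io_eq0 polyX_eq0. Qed.

(** A polynomial over C splits over C, so all its roots in L are constants. *)
Lemma algebraic_scalar (p : {poly C}) x :
  p != 0 -> root (map_poly scalar_emb p) x -> exists a, x = scalar_emb a.
Proof.
move=> nz_p; have [rs Dp] := closed_field_poly_normal p; rewrite Dp.
rewrite linearZ rootZ; last by rewrite fmorph_eq0 lead_coef_eq0.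
rewrite rmorph_prod (eq_bigr (fun a => 'X - (scalar_emb a)%:P)) => [|a _].
  rewrite -(big_map scalar_emb predT (fun z => 'X - z%:P)) root_prod_XsubC.
  by case/mapP=> a _ ->; exists a.
by rewrite rmorphB /= map_polyX map_polyC.
Qed.

Fact comm_inv_c : commr_rmorph scalar_emb c^-1.
Proof. by move=> a; apply: mulrC. Qed.

(** The coordinate ring of the projective line near infinity. *)
Definition io_inf : {poly C} -> L := horner_morph comm_inv_c.
HB.instance Definition _ := GRing.RMorphism.on io_inf.

Lemma io_infX : io_inf 'X = c^-1. Proof. exact: horner_morphX. Qed.

Lemma io_infC a : io_inf a%:P = scalar_emb a. Proof. exact: horner_morphC. Qed.

Lemma io_inf_inj : injective io_inf.
Proof.
suff io_inf_eq0 g : io_inf g = 0 -> g = 0.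
  by move=> g h eq_gh; apply/subr0_eq/io_inf_eq0; rewrite rmorphB /= eq_gh subrr.
move=> g0; apply/eqP/negPn/negP => nz_g.
have [a /(congr1 (@GRing.inv L))] := algebraic_scalar nz_g (introT rootP g0).
rewrite invrK -fmorphV /scalar_emb /= => /io_inj /(congr1 (size \o val)) /=.
by rewrite size_polyX size_polyC; case: eqP.
Qed.

End Transcendental.

(** The rational root theorem: after division by the gcd, an integral equation of
    a/b shows that b divides a power of a. *)
Lemma integrally_closed (C L : fieldType) (f : {rmorphism {poly C} -> L})
    (a b : {poly C}) z :
  injective f -> b != 0 -> f b * z = f a -> integralOver f z ->
  exists q, z = f q.
Proof.
move=> f_inj nz_b Dz [p mon_p pz0].
have f_eq0 q : (f q == 0) = (q == 0) by rewrite -(rmorph0 f) (inj_eq f_inj).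
pose g := gcdp a b; have nz_g : g != 0 by rewrite gcdp_eq0 negb_and nz_b orbT.
have [Da Db] : a = a %/ g * g /\ b = b %/ g * g.
  by rewrite !divpK ?dvdp_gcdl ?dvdp_gcdr.
have cop_ab : coprimep (a %/ g) (b %/ g) by rewrite coprimep_div_gcd // nz_b orbT.
have {nz_b} nz_b : b %/ g != 0.
  by apply: contra nz_b => /eqP b0; rewrite Db b0 mul0r.
have {Dz} : f (b %/ g) * z = f (a %/ g).
  apply: (@mulfI _ (f g)); first by rewrite f_eq0.
  by rewrite mulrA -!rmorphM /= ![g * _]mulrC -Da -Db.
move: (a %/ g) (b %/ g) cop_ab nz_b => {g nz_g Da Db} {}a {}b cop_ab nz_b Dz.
have [n Dn] : exists n, size p = n.+1.
  by exists (size p).-1; rewrite prednK // size_poly_gt0 monic_neq0.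
have fbz j : f (b ^+ j) * z ^+ j = f (a ^+ j).
  by rewrite !rmorphXn /= -exprMn Dz.
have b_dvd : b %| a ^+ n.
  have /eqP : f (\sum_(j < n.+1) p`_j * a ^+ j * b ^+ (n - j)) = 0.
    have := rootP pz0; rewrite horner_coef size_map_poly_id0; last first.
      by rewrite (monicP mon_p) rmorph1 oner_neq0.
    rewrite Dn => /(congr1 (fun x => f (b ^+ n) * x)); rewrite mulr0 => E; rewrite -[RHS]E {E}.
    rewrite rmorph_sum mulr_sumr; apply: eq_bigr => -[j /= lejn] _.
    rewrite coef_map /= !rmorphM /= -fbz.
    have -> : b ^+ n = b ^+ j * b ^+ (n - j) by rewrite -exprD subnKC.
    by rewrite rmorphM /=; ring.
  rewrite f_eq0 big_ord_recr /= subnn expr0 mulr1.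
  have -> : p`_n = 1 by move/monicP: mon_p; rewrite lead_coefE Dn.
  rewrite mul1r addrC addr_eq0 => /eqP->; rewrite dvdpNr.
  elim/big_ind: _ => [|x y|j _]; [exact: dvdp0 | exact: dvdp_add |].
  by rewrite dvdp_mull // dvdp_exp // subn_gt0.
have : size b == 1.
  have : coprimep b (a ^+ n) by rewrite coprimep_expr // coprimep_sym.
  by rewrite /coprimep (eqp_size (dvdp_gcd_idl b_dvd)).
case/size_poly1P => e nz_e De; exists (e^-1 *: a).
apply: (@mulfI _ (f b)); first by rewrite f_eq0.
by rewrite Dz -rmorphM De mul_polyC scalerA divff // scale1r.
Qed.

Lemma integral_power (R K : comNzRingType) (f : {rmorphism R -> K}) z n :
  (0 < n)%N -> integralOver f (z ^+ n) -> integralOver f z.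
Proof.
move=> n_gt0 int_zn; apply: (@integral_root_monic _ _ _ _ ('X^n - (z ^+ n)%:P)).
- by apply: monicXnsubC.
- by rewrite /root !hornerE subrr.
apply/integral_poly => i; rewrite coefB coefXn coefC; apply: integral_sub.
  exact: integral_nat.
by case: eqP => // _; apply: integral0.
Qed.

(** * The filtration at infinity *)

Section Infinity.

Variables (C : numClosedFieldType) (L : fieldType).
Variable io : {rmorphism {poly C} -> L}.
Hypothesis io_inj : injective io.

Local Notation c := (io 'X).
Local Notation int_inf := (integralOver (io_inf io)).

(** C[1/c] is integrally closed and does not contain c. *)
Lemma X_not_integral_inf : ~ int_inf c.
Proof.
move=> int_c; have nz_c := io_X_neq0 io_inj.
have nz_X : 'X != 0 :> {poly C} by rewrite polyX_eq0.
have Dc : io_inf io 'X * c = io_inf io 1 by rewrite io_infX mulVf // rmorph1.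
have [q Dq] := integrally_closed (io_inf_inj io_inj) nz_X Dc int_c.
have : io_inf io ('X * q) = io_inf io 1.
  by rewrite rmorphM /= io_infX -Dq mulVf // rmorph1.
move/(io_inf_inj io_inj)/(congr1 (horner^~ 0))/eqP.
by rewrite !hornerE eq_sym oner_eq0.
Qed.

Variable k : nat.
Hypothesis k_gt0 : (0 < k)%N.

(** Growth at most c^(r/k) at every place above infinity. Since c^(1/k) need not
    belong to L, the k-th power of z is compared with c^r; and an element is bounded
    at these places when it is integral over C[1/c]. *)
Definition growth (r : int) (z : L) := int_inf (z ^+ k * c ^ (- r)).

Let nz_c : c != 0. Proof. exact: io_X_neq0. Qed.

Lemma integral_inf_V n : int_inf (c ^- n).
Proof.
by rewrite -exprVn -io_infX -rmorphXn; apply: (integral_id (io_inf io)).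
Qed.

Lemma growth_mono r s z : (r <= s)%R -> growth r z -> growth s z.
Proof.
rewrite -subr_ge0 /growth => /gez0_abs; move: absz => n; set m := n _ => Dm int_z.
have -> : (- s = - r - m%:Z)%R by rewrite Dm; ring.
by rewrite expfzDr // mulrA -exprnN; apply: integral_mul int_z (integral_inf_V m).
Qed.

Lemma growth_mul r s x y : growth r x -> growth s y -> growth (r + s) (x * y).
Proof.
rewrite /growth => int_x int_y; rewrite opprD expfzDr // exprMn.
by rewrite mulrACA; apply: integral_mul.
Qed.

Lemma integral_sum I (s : seq I) (P : pred I) (F : I -> L) :
  (forall i, P i -> int_inf (F i)) -> int_inf (\sum_(i <- s | P i) F i).
Proof.
by move=> intF; apply: big_ind => //; [apply: integral0 | apply: integral_add].
Qed.

Lemma integral_exp x n : int_inf x -> int_inf (x ^+ n).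
Proof.
move=> int_x; elim: n => [|n IHn]; first exact: integral1.
by rewrite exprS; apply: integral_mul.
Qed.

(** Binomial expansion; the k-th power of each term factors into powers of
    x^k/c^r and y^k/c^r. *)
Lemma growth_add r x y : growth r x -> growth r y -> growth r (x + y).
Proof.
rewrite /growth => int_x int_y; rewrite exprDn mulr_suml.
apply: integral_sum => -[i /= lti] _; rewrite mulrnAl -mulr_natl.
apply: integral_mul; first exact: integral_nat.
apply: (integral_power k_gt0); set z := (_ ^+ k).
have -> : z = (x ^+ k * c ^ (- r)) ^+ (k - i) * (y ^+ k * c ^ (- r)) ^+ i.
  rewrite /z !exprMn mulrACA -[in RHS]exprD subnK -1?ltnS //.
  by congr (_ * _); rewrite -!exprM ![(k * _)%N]mulnC.
by apply: integral_mul; apply: integral_exp.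
Qed.

Lemma growth_scalar a : growth 0 (io a%:P).
Proof.
rewrite /growth oppr0 expr0z mulr1; apply: integral_exp.
by rewrite -[io _]/(scalar_emb io a) -io_infC; apply: (integral_id (io_inf io)).
Qed.

Lemma growth_expX (n : int) : growth (k%:Z * n) (c ^ n).
Proof.
rewrite /growth exprnP exprz_exp -expfzDr // mulrC subrr expr0z.
exact: integral1.
Qed.

Lemma growth_X : growth k c.
Proof. by have := growth_expX 1; rewrite mulr1. Qed.

Lemma growth_XV : growth (- k%:Z) c^-1.
Proof. by have := growth_expX (-1); rewrite mulrN1. Qed.

Lemma growth1 : growth 0 1.
Proof. by have := growth_scalar 1; rewrite rmorph1. Qed.

Lemma growth0 r : growth r 0.
Proof. by rewrite /growth expr0n eqn0Ngt k_gt0 mul0r; apply: integral0. Qed.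

Lemma growth_opp r z : growth r z -> growth r (- z).
Proof.
move=> gr_z; rewrite -mulN1r -[r]add0r; apply: growth_mul gr_z.
by have := growth_scalar (-1); rewrite !rmorphN !rmorph1.
Qed.

(** Integrality over C[1/c] is a condition at all places where c is not 0; the
    factor e = 1 + o(1) leaves only those above infinity, and makes the filtration
    stable under inversion of such elements. *)
Definition asymp (r : int) (z : L) :=
  exists2 e, growth (-1) (e - 1) & growth r (e * z).

Lemma growth_unit e : growth (-1) (e - 1) -> growth 0 e.
Proof.
by move=> gr_e; rewrite -[e](subrK 1); apply: growth_add growth1; apply: growth_mono gr_e.
Qed.

Lemma growth_unitM e e' :
  growth (-1) (e - 1) -> growth (-1) (e' - 1) -> growth (-1) (e * e' - 1).
Proof.
move=> gr_e gr_e'; have -> : e * e' - 1 = (e - 1) * e' + (e' - 1) by ring.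
apply: growth_add (gr_e'); rewrite -[X in growth X _]addr0.
exact: growth_mul gr_e (growth_unit gr_e').
Qed.

Lemma asymp_growth r z : growth r z -> asymp r z.
Proof.
move=> gr_z; exists 1; last by rewrite mul1r.
by rewrite subrr; apply: growth0.
Qed.

Lemma asymp_mono r s z : r <= s -> asymp r z -> asymp s z.
Proof. by move=> le_rs [e]; exists e => //; apply: growth_mono le_rs _. Qed.

Lemma asymp_mul r s x y : asymp r x -> asymp s y -> asymp (r + s) (x * y).
Proof.
move=> [e gr_e gr_x] [e' gr_e' gr_y]; exists (e * e'); first exact: growth_unitM.
by rewrite mulrACA; apply: growth_mul.
Qed.

Lemma asymp_add r x y : asymp r x -> asymp r y -> asymp r (x + y).
Proof.
move=> [e gr_e gr_x] [e' gr_e' gr_y]; exists (e * e'); first exact: growth_unitM.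
have -> : e * e' * (x + y) = e' * (e * x) + e * (e' * y) by ring.
by apply: growth_add; rewrite -[r]add0r; apply: growth_mul => //; apply: growth_unit.
Qed.

Lemma asymp_opp r z : asymp r z -> asymp r (- z).
Proof. by case=> e gr_e gr_z; exists e; rewrite ?mulrN //; apply: growth_opp. Qed.

Lemma asymp_inv e : asymp (-1) (e - 1) -> asymp 0 e^-1.
Proof.
have [-> _|nz_e] := eqVneq e 0.
  by rewrite invr0; apply/asymp_growth/growth0.
case=> e' gr_e' gr_e; exists (e' * e); last by rewrite mulfK //; apply: growth_unit.
have -> : e' * e - 1 = e' * (e - 1) + (e' - 1) by ring.
exact: growth_add.
Qed.

(** If 1 = e - (e - 1) were infinitesimal, c would be integral over C[1/c]. *)
Lemma asymp_nontrivial : ~ asymp (-1) 1.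
Proof.
case=> e gr_e; rewrite mulr1 => gr_e1; apply: X_not_integral_inf.
have : growth (-1) (e - (e - 1)) by apply: growth_add gr_e1 (growth_opp gr_e).
by rewrite opprB addrC subrK /growth expr1n mul1r opprK expr1z.
Qed.

Lemma asymp_horner (p : {poly C}) n :
  (size p <= n.+1)%N -> asymp (k * n)%N (io p).
Proof.
move=> szp; rewrite -[p]coefK poly_def rmorph_sum /=.
apply: big_ind => [||[i /= lti] _]; [exact/asymp_growth/growth0 | exact: asymp_add |].
rewrite -mul_polyC (rmorphM io) (rmorphXn io) /=; apply/asymp_growth.
apply: (@growth_mono (0 + (k%:Z * i%:Z))); last first.
  by apply: growth_mul (growth_scalar _) (growth_expX _).
by rewrite add0r -PoszM lez_nat leq_mul2l -ltnS (leq_trans lti) ?orbT.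
Qed.

(** Otherwise the leading term is as small as the lower ones, and dividing by it
    makes 1 infinitesimal. *)
Lemma asymp_poly (p : {poly C}) : asymp 0 (io p) -> exists a, p = a%:P.
Proof.
move=> as_p; have [/size1_polyC->|] := leqP (size p) 1; first by exists p`_0.
case Dn: (size p) => [|[|n]] // _; case: asymp_nontrivial.
pose a := lead_coef p; have nz_a : a != 0 by rewrite lead_coef_eq0 -size_poly_gt0 Dn.
pose q := p - a *: 'X^(n.+1).
have szq : (size q <= n.+1)%N.
  apply/leq_sizeP => j lenj; rewrite coefB coefZ coefXn.
  move: lenj; rewrite leq_eqVlt => /predU1P[<-|ltnj].
    by rewrite eqxx mulr1 /a lead_coefE Dn subrr.
  by rewrite nth_default ?Dn // gtn_eqF // mulr0 subrr.
have : asymp (k * n)%N (io (p - q)).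
  rewrite rmorphB; apply: asymp_add; first by apply: asymp_mono as_p.
  exact/asymp_opp/asymp_horner.
rewrite subKr -mul_polyC (rmorphM io) (rmorphXn io) /= => as_lead.
have as_V : asymp (0 + k%:Z * - n.+1%:Z) (io (a^-1)%:P * c ^ (- n.+1%:Z)).
  by apply/asymp_growth/growth_mul; [apply: growth_scalar | apply: growth_expX].
have := asymp_mul as_lead as_V.
have -> : io a%:P * c ^+ n.+1 * (io a^-1%:P * c ^ (- n.+1%:Z)) = 1.
  by rewrite mulrACA exprnP -expfzDr // subrr expr0z mulr1 -rmorphM -polyCM divff ?rmorph1.
by apply: asymp_mono; lia.
Qed.

End Infinity.

(** * Bounded integral elements are constant *)

(** The coefficients are polynomials with integer coefficients in the roots. *)
Lemma prod_XsubC_closed (L : comNzRingType) (V : L -> Prop) n (x : 'I_n -> L) :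
  V 0 -> V 1 -> (forall u v, V u -> V v -> V (u - v)) ->
  (forall u v, V u -> V v -> V (u * v)) ->
  (forall j, V (x j)) -> forall i, V (\prod_j ('X - (x j)%:P))`_i.
Proof.
move=> V0 V1 VB VM Vx.
have VN u : V u -> V (- u) by move=> Vu; rewrite -[- u]sub0r; apply: VB.
elim/big_ind: _ => [i|p q Vp Vq i|j _ i].
- by rewrite coefC; case: eqP.
- rewrite coefM; elim/big_ind: _ => // [u v Vu Vv|h _]; last exact: VM.
  by rewrite -[v]opprK; apply: VB => //; apply: VN.
by rewrite coefB coefX coefC; apply: VB; do ?case: eqP.
Qed.

Lemma antiderivative (R : numFieldType) (q : {poly R}) : exists Q, Q^`() = q.
Proof.
exists (\poly_(i < (size q).+1) (q`_i.-1 / i%:R)); apply/polyP => i.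
rewrite coef_deriv coef_poly ltnS; case: ltnP => [_|leqi].
  by rewrite -[LHS]mulr_natr divfK // pnatr_eq0.
by rewrite mul0rn nth_default.
Qed.

Lemma integral_coprime (C L : fieldType) (f : {rmorphism {poly C} -> L})
    (g h : {poly C}) z :
  coprimep g h -> integralOver f (f g * z) -> integralOver f (f h * z) ->
  integralOver f z.
Proof.
case/Bezout_eq1_coprimepP=> -[u v] /= Duv int_g int_h.
have -> : z = f u * (f g * z) + f v * (f h * z).
  by rewrite !mulrA -mulrDl -!rmorphM -rmorphD Duv rmorph1 mul1r.
by apply: integral_add; apply: integral_mul => //; apply: (integral_id f).
Qed.

Section BoundedConstant.

Variables (C : numClosedFieldType) (L : fieldType).
Variable io : {rmorphism {poly C} -> L}.
Hypothesis io_inj : injective io.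
Variable k : nat.
Hypothesis k_gt0 : (0 < k)%N.

(** What a Galois extension of C(c) provides: embeddings s_j over C[c], one of them
    fixing z, such that the product of the X - s_j(z) has coefficients in C(c). *)
Definition has_conjugates (z : L) := exists n (s : 'I_n -> {rmorphism L -> L}),
  [/\ forall j p, s j (io p) = io p, exists j, s j z = z
    & forall i, exists2 ab, ab.2 != 0
        & io ab.2 * (\prod_j ('X - (s j z)%:P))`_i = io ab.1].

Lemma integral_conj (f : {rmorphism {poly C} -> L}) (s : {rmorphism L -> L}) z :
  (forall p, s (f p) = f p) -> integralOver f z -> integralOver f (s z).
Proof.
move=> sf [p mon_p pz0]; exists p => //.
have -> : map_poly f p = map_poly s (map_poly f p).
  by apply/polyP => i; rewrite !coef_map /= sf.
exact: rmorph_root.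
Qed.

Lemma asymp_conj (s : {rmorphism L -> L}) r z :
  (forall p, s (io p) = io p) -> asymp io k r z -> asymp io k r (s z).
Proof.
move=> sio.
have s_inf p : s (io_inf io p) = io_inf io p.
  rewrite /io_inf /horner_morph -horner_map fmorphV /= sio; congr _.[_].
  by apply/polyP => i; rewrite !coef_map /= sio.
have s_gr r' z' : growth io k r' z' -> growth io k r' (s z').
  by rewrite /growth -{2}sio -fmorphXz -rmorphXn -rmorphM; apply: integral_conj.
case=> e gr_e gr_z; exists (s e); last by rewrite -rmorphM; apply: s_gr.
by rewrite -(rmorph1 s) -rmorphB; apply: s_gr.
Qed.

(** The symmetric functions of the conjugates are polynomials in c bounded at
    infinity, so the characteristic polynomial has constant coefficients. *)
Lemma bounded_integral_constant z :
  has_conjugates z -> integralOver io z -> asymp io k 0 z ->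
  exists a, z = io a%:P.
Proof.
case=> n [s [s_io [j0 s_z] fracP]] int_z as_z.
set p := \prod_j _ in fracP.
have coef_p i : exists a, p`_i = scalar_emb io a.
  have int_pi : integralOver io p`_i.
    apply: prod_XsubC_closed; first exact: integral0.
    - exact: integral1.
    - exact: integral_sub.
    - exact: integral_mul.
    - by move=> j; apply: integral_conj.
  have as_pi : asymp io k 0 p`_i.
    apply: prod_XsubC_closed; first exact/asymp_growth/growth0.
    - exact/asymp_growth/growth1.
    - by move=> u v as_u as_v; apply: asymp_add => //; apply: asymp_opp.
    - by move=> u v; apply: asymp_mul.
    - by move=> j; apply: asymp_conj.
  have [[a b] /= nz_b Dpi] := fracP i.
  have [q Dq] := integrally_closed io_inj nz_b Dpi int_pi.
  rewrite Dq in as_pi *; have [e ->] := asymp_poly io_inj k_gt0 as_pi.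
  by exists e.
have [a Da] := choice coef_p.
pose g := \poly_(i < size p) a i.
have Dg : map_poly (scalar_emb io) g = p.
  apply/polyP => i; rewrite coef_map coef_poly /=; case: ltnP => // lepi.
  by rewrite (rmorph0 (scalar_emb io)) nth_default.
apply: (@algebraic_scalar _ _ io g).
  rewrite -(map_poly_eq0 (scalar_emb io)) Dg.
  exact/monic_neq0/monic_prod_XsubC.
by rewrite Dg /root horner_prod (bigD1 j0) //= !hornerE s_z subrr mul0r.
Qed.

Variable D : L -> L.
Hypothesis der_D : derivation D.
Hypothesis D_io : forall p, D (io p) = io p^`().
Hypothesis D_ker : forall z, D z = 0 -> exists a, z = io a%:P.

(** Simple connectedness of the affine line. [W r z] stands for: z is integral over
    C[c] together with all its derivatives, and grows at most like c^(r/k). Induction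
    on r: D z is a polynomial q by induction, and z differs from an antiderivative of
    q by an element killed by D. *)
Lemma integral_asymp_poly (W : int -> L -> Prop) :
  (forall z, has_conjugates z) ->
  (forall r z, W r z -> integralOver io z) ->
  (forall r z, W r z -> asymp io k r z) ->
  (forall r z, W r z -> W (r - 1) (D z)) ->
  forall (n : nat) z, W n z -> exists q, z = io q.
Proof.
move=> conjL intW asW DW; elim=> [|n IHn] z Wz.
  have [a ->] := bounded_integral_constant (conjL z) (intW _ _ Wz) (asW _ _ Wz).
  by exists a%:P.
have /IHn[q Dq] : W n (D z) by have := DW _ _ Wz; rewrite intS addrC addKr.
have [Q DQ] := antiderivative q.
have [|a Da] := D_ker (z := z - io Q).
  by rewrite derivationB // D_io DQ Dq subrr.
by exists (Q + a%:P); rewrite rmorphD /= -Da addrC subrK.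
Qed.

End BoundedConstant.

(** * Periodic points at infinity *)

Section GrowthFiltration.

Variables (C : numClosedFieldType) (L : fieldType).
Variable io : {rmorphism {poly C} -> L}.
Hypothesis io_inj : injective io.
Variable k : nat.
Hypothesis k_gt1 : (1 < k)%N.
Let k_gt0 : (0 < k)%N. Proof. exact: ltnW. Qed.

Local Notation c := (io 'X).
Let nz_c : c != 0. Proof. exact: io_X_neq0. Qed.

(** The growth filtration is not obviously stable under D, so it is replaced by a
    smaller one, spanned by expressions in elements of known derivative; the weight
    of an expression is the growth that can be read off from its form. The inverses
    are those of elements 1 + o(1), needed to solve for the derivatives of the
    generators. *)
Inductive weight (S : L -> Prop) : int -> L -> Prop :=
| weight_scalar a : weight S 0 (io a%:P)
| weight_X : weight S k c
| weight_XV : weight S (- k%:Z) c^-1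
| weight_gen x : S x -> weight S 1 x
| weight_mono r s z : r <= s -> weight S r z -> weight S s z
| weight_add r x y : weight S r x -> weight S r y -> weight S r (x + y)
| weight_mul r s x y : weight S r x -> weight S s y -> weight S (r + s) (x * y)
| weight_inv e : weight S (-1) (e - 1) -> weight S 0 e^-1.

Lemma weight_asymp (S : L -> Prop) r z :
  (forall x, S x -> asymp io k 1 x) -> weight S r z -> asymp io k r z.
Proof.
move=> asS; elim=> {r z} [a||| x /asS //| r s z le_rs _| r x y _ asx _ | r s x y _ asx _ | e _].
- exact/asymp_growth/growth_scalar.
- exact/asymp_growth/growth_X.
- exact/asymp_growth/growth_XV.
- exact: asymp_mono.
- exact: asymp_add.
- exact: asymp_mul.
- exact: asymp_inv.
Qed.

Section Weights.

Variable S : L -> Prop.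
Hypothesis asS : forall x, S x -> asymp io k 1 x.

Lemma weight1 : weight S 0 1.
Proof. by have := weight_scalar S 1; rewrite rmorph1. Qed.

Lemma weight0 r : weight S r 0.
Proof.
have w0 (n : nat) : weight S (- n%:Z) 0.
  elim: n => [|n IHn]; first by have := weight_scalar S 0; rewrite polyC0 rmorph0.
  apply: (@weight_mono _ (- n%:Z + - k%:Z)); first by lia.
  by rewrite -(mul0r c^-1); apply: weight_mul IHn (weight_XV S).
by apply: weight_mono (w0 `|r|%N); lia.
Qed.

Lemma weight_opp r z : weight S r z -> weight S r (- z).
Proof.
move=> wz; rewrite -mulN1r -[r]add0r; apply: weight_mul wz.
by have := weight_scalar S (-1); rewrite !rmorphN !rmorph1.
Qed.

Lemma weight_sub r x y : weight S r x -> weight S r y -> weight S r (x - y).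
Proof. by move=> wx wy; apply: weight_add => //; apply: weight_opp. Qed.

Lemma weight_nontrivial : ~ weight S (-1) 1.
Proof. by move/(weight_asymp asS)/(asymp_nontrivial io_inj). Qed.

Lemma weight_unit_neq0 e : weight S (-1) (e - 1) -> e != 0.
Proof.
move=> we; apply/eqP => e0; apply: weight_nontrivial.
by move: we; rewrite e0 sub0r => /weight_opp; rewrite opprK.
Qed.

Lemma weight_poly (p : {poly C}) : exists n : nat, weight S n (io p).
Proof.
elim/poly_ind: p => [|p a [n wp]].
  by exists 0%N; have := weight_scalar S 0; rewrite polyC0.
exists (n + k)%N; rewrite (rmorphD io) (rmorphM io); apply: weight_add.
  by rewrite PoszD; apply: weight_mul wp (weight_X S).
exact: weight_mono (weight_scalar S a).
Qed.

Variable D : L -> L.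
Hypothesis der_D : derivation D.
Hypothesis D_io : forall p, D (io p) = io p^`().

(** By Leibniz it is enough to look at the generators; for c and 1/c the weight
    drops by exactly k. *)
Lemma weight_der r z :
  (forall x, S x -> weight S (1 - k%:Z) (D x)) ->
  weight S r z -> weight S (r - k%:Z) (D z).
Proof.
move=> DS; elim=> {r z} [a||| x /DS //| r s z le_rs _| r x y wx Dx wy Dy | r s x y wx Dx wy Dy| e we De].
- by rewrite D_io derivC rmorph0; apply: weight0.
- by rewrite D_io derivX rmorph1 subrr; apply: weight1.
- rewrite derivationV // D_io derivX rmorph1 mulr1; apply: weight_opp.
  by rewrite -exprVn expr2; apply: weight_mul; apply: weight_XV.
- by apply: weight_mono; lia.
- by rewrite derivationD //; apply: weight_add.
- rewrite derivationM //; apply: weight_add.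
    by rewrite addrAC; apply: weight_mul.
  by rewrite -addrA; apply: weight_mul.
rewrite derivationV // mulNr; apply: weight_opp; rewrite -exprVn expr2.
apply: weight_mul; first by rewrite -[0]addr0; apply: weight_mul; apply: weight_inv.
move: De; rewrite (derivationB der_D) (derivation1 der_D) subr0.
by apply: weight_mono; lia.
Qed.

End Weights.

Variable a : C.
Definition unicritical (x : L) := x ^+ k + (c + io a%:P).

Variable N : nat.
Hypothesis N_gt0 : (0 < N)%N.
Definition periodic (x : L) := iter N unicritical x = x.

Lemma periodic_orbit x j : periodic x -> periodic (iter j unicritical x).
Proof. by rewrite /periodic -iterD addnC iterD => ->. Qed.

(** Put w = 1/c and y_j = x_j^k/c along the orbit x_j. Dividing x_j^k + c + a =
    x_(j+1) by c and raising to the power k gives (y_j + 1 + a w)^k =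
    w^(k-1) y_(j+1). By iteration w^n y_j is a monic polynomial in y_0 over C[w],
    of degree k^j. For j = N, where y_N = y_0, this is an integral equation of y_0
    because k^N > 1. *)
Lemma periodic_asymp x : periodic x -> asymp io k 1 x.
Proof.
move=> per_x; apply: asymp_growth => //; rewrite /growth exprN1.
pose w := c^-1; pose y j := iter j unicritical x ^+ k / c.
have y_rec j : (y j + 1 + io a%:P * w) ^+ k = w ^+ k.-1 * y j.+1.
  have -> : y j + 1 + io a%:P * w = iter j.+1 unicritical x * w.
    by rewrite /y /w iterS /unicritical; field.
  by rewrite exprMn -{2}(prednK k_gt0) exprSr /y /w; ring.
pose ev (H : {poly {poly C}}) := (map_poly (io_inf io) H).[y 0%N].
have [n [H [mon_H szH evH]]] : exists n (H : {poly {poly C}}),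
    [/\ H \is monic, size H = (k ^ N).+1 & ev H = w ^+ n * y N].
  elim: {1 2}N => [|j [n [H [mon_H szH evH]]]].
    exists 0%N, 'X; rewrite monicX size_polyX expn0; split=> //.
    by rewrite /ev map_polyX hornerX mul1r.
  (* (w^n y_j + w^n (1 + a w))^k = w^(n k) w^(k-1) y_(j+1) *)
  exists (n * k + k.-1)%N, ((H + ('X^n * (1 + a *: 'X))%:P) ^+ k).
  have szH1 : (1 < size H)%N by rewrite szH ltnS expn_gt0 k_gt0.
  have mon_H1 : H + ('X^n * (1 + a *: 'X))%:P \is monic.
    by rewrite monicE lead_coefDl ?(eqP mon_H) // (leq_ltn_trans (size_polyC_leq1 _)).
  split; first exact: monic_exp.
    have := size_exp (H + ('X^n * (1 + a *: 'X))%:P) k.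
    rewrite size_polyDl ?(leq_ltn_trans (size_polyC_leq1 _)) // szH /= -expnSr => <-.
    by rewrite prednK // size_poly_gt0 expf_neq0 // monic_neq0.
  rewrite /ev rmorphXn rmorphD /= map_polyC /= horner_exp hornerD hornerC -/(ev H).
  rewrite evH rmorphM rmorphXn rmorphD rmorph1 /= -mul_polyC rmorphM /= io_infX io_infC.
  rewrite -/w -mulrDr exprMn addrA -exprM y_rec mulrA -exprD //.
exists (H - ('X^n)%:P * 'X).
  rewrite monicE lead_coefDl ?(eqP mon_H) // size_polyN szH.
  apply: leq_ltn_trans (_ : 2 < _)%N.
    by rewrite mul_polyC (leq_trans (size_scale_leq _ _)) // size_polyX.
  by rewrite ltnS -[1%N](expn0 k) ltn_exp2l.
rewrite /root rmorphB hornerD hornerN -/(ev H) evH rmorphM /= map_polyC map_polyX /=.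
rewrite !hornerE rmorphXn /= io_infX.
by rewrite /y per_x subrr.
Qed.

Let asP := periodic_asymp.

(** Differentiating x_(j+1) = x_j^k + c + a expresses D x_j as an affine function of
    D x_(j+1) with coefficients of weight 1 - k. Going once around the cycle gives
    D x = A + B D x, where 1 - B can be inverted because B has weight 1 - k < 0. *)
Lemma periodic_weight_der (D : L -> L) x :
  derivation D -> (forall p, D (io p) = io p^`()) ->
  periodic x -> weight periodic (1 - k%:Z) (D x).
Proof.
move=> der_D D_io per_x; pose xx j := iter j unicritical x.
have w_x j : weight periodic 1 (xx j) by apply/weight_gen/periodic_orbit.
(* x_j^k = - c e_j with e_j = 1 + o(1) *)
pose e j := 1 - (xx j.+1 - io a%:P) / c.
have we j : weight periodic (-1) (e j - 1).
  rewrite /e addrC addKr; apply: weight_opp.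
  apply: (@weight_mono _ (1 + - k%:Z)); first by lia.
  apply: weight_mul (weight_XV _); apply: weight_sub => //.
  exact: weight_mono (weight_scalar _ _).
have nz_e j : e j != 0 := weight_unit_neq0 asP (we j).
have nz_k : k%:R != 0 :> L.
  by rewrite -(rmorph_nat io) io_eq0 // -polyC_natr polyC_eq0 pnatr_eq0 -lt0n.
have io_natV : io (k%:R^-1)%:P = k%:R^-1.
  by rewrite -[LHS]/(scalar_emb io _) fmorphV rmorph_nat.
have xk j : xx j ^+ k = - c * e j.
  by rewrite /e /xx iterS /unicritical; field.
(* g_j = 1 / (k x_j^(k-1)), written without inverting x_j *)
pose g j := - ((io (k%:R^-1)%:P) * c^-1 * (e j)^-1 * xx j).
have wg j : weight periodic (1 - k%:Z) (g j).
  apply: weight_opp; apply: (@weight_mono _ (0 + - k%:Z + 0 + 1)); first by lia.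
  apply: weight_mul => //; apply: weight_mul; last exact: weight_inv.
  by apply: weight_mul; [apply: weight_scalar | apply: weight_XV].
have Dxx j : D (xx j) = g j * (D (xx j.+1) - 1).
  have -> : D (xx j.+1) = xx j ^+ k.-1 * D (xx j) *+ k + 1.
    rewrite /xx iterS {1}/unicritical !(derivationD der_D) derivationX // !D_io.
    by rewrite derivX derivC rmorph1 rmorph0 addr0.
  have xxk : xx j * xx j ^+ k.-1 = - c * e j by rewrite -exprS prednK.
  rewrite addrK /g io_natV -(mulr_natr (_ * D (xx j)) k).
  transitivity (- (k%:R^-1 * c^-1 * (e j)^-1 * (xx j * xx j ^+ k.-1) * D (xx j) * k%:R)).
    by rewrite xxk; field; rewrite nz_c nz_e nz_k.
  by ring.
have cyc n : exists A B, [/\ weight periodic (1 - k%:Z) A,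
    weight periodic (1 - k%:Z) B & D x = A + B * D (xx n.+1)].
  elim: n => [|n [A [B [wA wB ->]]]].
    exists (- g 0%N), (g 0%N); split=> //; first exact: weight_opp.
    by rewrite -[D x]/(D (xx 0%N)) Dxx; ring.
  exists (A - B * g n.+1), (B * g n.+1); split.
  - apply: weight_sub => //; apply: weight_mono (weight_mul wB (wg _)); lia.
  - apply: weight_mono (weight_mul wB (wg _)); lia.
  by rewrite Dxx; ring.
have [A [B [wA wB]]] := cyc N.-1.
rewrite prednK // /xx per_x => DxE.
have wB1 : weight periodic (-1) ((1 - B) - 1).
  by rewrite addrC addKr; apply: weight_opp; apply: weight_mono wB; lia.
have nzB := weight_unit_neq0 asP wB1.
have -> : D x = A * (1 - B)^-1 by apply: (canRL (mulfK nzB)); rewrite mulrBr mulr1 mulrC {1}DxE addrK.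
by rewrite -[_ - _]addr0; apply: weight_mul => //; apply: weight_inv.
Qed.

End GrowthFiltration.

(** * The polynomials of periodic points *)

Lemma lead_coef_deriv_monic (R : numDomainType) (P : {poly {poly R}}) n :
  P \is monic -> size P = n.+1 -> (0 < n)%N ->
  size P^`() = n /\ lead_coef P^`() = n%:R.
Proof.
move=> monP szP n_gt0; have Pn : P`_n = 1 by move/monicP: monP; rewrite lead_coefE szP.
have coefP' : P^`()`_n.-1 = n%:R by rewrite coef_deriv prednK // Pn.
have nz_n : n%:R != 0 :> {poly R} by rewrite -polyC_natr polyC_eq0 pnatr_eq0 -lt0n.
have szP' : size P^`() = n.
  apply/eqP; rewrite eqn_leq -ltnS -szP lt_size_deriv ?monic_neq0 //=.
  rewrite leqNgt; apply: contra nz_n => lt_sz; rewrite -coefP' nth_default //.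
  by rewrite -ltnS prednK.
by split=> //; rewrite lead_coefE szP'.
Qed.

Section PeriodicPolynomials.

Variables (C : numClosedFieldType) (k : nat).
Hypothesis k_gt1 : (1 < k)%N.

Definition iter_poly (a : C) (n : nat) : {poly {poly C}} :=
  iter n (fun h => ('X^k + ('X + a%:P)%:P) \Po h) 'X.

Definition per_poly (a : C) (n : nat) := iter_poly a n - 'X.

Lemma iter_polyS a n :
  iter_poly a n.+1 = iter_poly a n ^+ k + ('X + a%:P)%:P.
Proof. by rewrite /iter_poly iterS comp_polyD comp_polyC comp_Xn_poly. Qed.

Lemma map_iter_poly (S : comNzRingType) (f : {rmorphism {poly C} -> S}) a n :
  map_poly f (iter_poly a n) =
    iter n (fun h => ('X^k + (f ('X + a%:P))%:P) \Po h) 'X.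
Proof.
elim: n => [|n IHn]; first exact: map_polyX.
have mapf b : map_poly f ('X^k + b%:P) = 'X^k + (f b)%:P.
  by rewrite rmorphD /= map_polyXn map_polyC.
by rewrite iterS -IHn /iter_poly iterS map_comp_poly mapf.
Qed.

Lemma size_iter_poly a n :
  size (iter_poly a n) = (k ^ n).+1 /\ iter_poly a n \is monic.
Proof.
elim: n => [|n [szf monf]]; first by rewrite size_polyX monicX.
have szfk : size (iter_poly a n ^+ k) = (k ^ n.+1).+1.
  have := size_exp (iter_poly a n) k; rewrite szf /= -expnSr => <-.
  by rewrite prednK // size_poly_gt0 expf_neq0 // monic_neq0.
have lt_sz : (size (('X + a%:P)%:P : {poly {poly C}}) < size (iter_poly a n ^+ k))%N.
  by rewrite (leq_ltn_trans (size_polyC_leq1 _)) // szfk ltnS expn_gt0 ltnW.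
rewrite iter_polyS size_polyDl // szfk; split=> //.
by rewrite monicE lead_coefDl // -monicE monic_exp.
Qed.

Lemma monic_per_poly a n : (0 < n)%N -> per_poly a n \is monic.
Proof.
move=> n_gt0; have [szf monf] := size_iter_poly a n.
rewrite monicE lead_coefDl ?(monicP monf) // size_polyN size_polyX szf ltnS.
have K_gt1 : (1 < k ^ n)%N by rewrite -[1%N](expn0 k) ltn_exp2l.
exact: K_gt1.
Qed.

Lemma horner_iter_poly (L : fieldType) (io : {rmorphism {poly C} -> L}) a n x :
  (map_poly io (iter_poly a n)).[x] = iter n (unicritical io k a) x.
Proof.
elim: n => [|n IHn]; first by rewrite map_polyX hornerX.
rewrite iter_polyS iterS rmorphD rmorphXn /= map_polyC hornerD horner_exp hornerC.
by rewrite IHn /unicritical -(rmorphD io).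
Qed.

Lemma root_per_poly (L : fieldType) (io : {rmorphism {poly C} -> L}) a n x :
  root (map_poly io (per_poly a n)) x <-> periodic io k a n x.
Proof.
rewrite /root rmorphB /= map_polyX hornerD hornerN hornerX horner_iter_poly.
by rewrite subr_eq0; split=> /eqP.
Qed.

Lemma per_poly_shift a n :
  per_poly a n = map_poly (comp_poly ('X + a%:P)) (per_poly 0 n).
Proof.
rewrite /per_poly rmorphB /= map_polyX.
by rewrite (map_iter_poly (comp_poly ('X + a%:P))) polyC0 addr0 /= comp_polyX.
Qed.

(** The polynomial d is the resultant of P and P'. It does not vanish at c = 0, where
    the equation is x^(k^n) = x: a double root x would satisfy k^n x = x, and
    x = 0 is a simple root. *)
Lemma per_poly_bezout n : (0 < n)%N ->
  exists2 d : {poly C}, d != 0 &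
  exists u v, u * per_poly 0 n + v * (per_poly 0 n)^`() = d%:P.
Proof.
move=> n_gt0; set P := per_poly 0 n.
have K_gt1 : (1 < k ^ n)%N by rewrite -[1%N](expn0 k) ltn_exp2l.
have monP : P \is monic by apply: monic_per_poly.
have szP : size P = (k ^ n).+1.
  by have [szf _] := size_iter_poly 0 n; rewrite size_polyDl ?szf // size_polyN size_polyX ltnS.
have [szP' lead'] := lead_coef_deriv_monic monP szP (ltnW K_gt1).
have [||[u v] _ DuV] := @resultant_in_ideal _ P P^`().
- by rewrite szP ltnS ltnW.
- by rewrite szP'.
exists (resultant P P^`()); last by exists u, v.
have ev0 : map_poly (horner_eval 0) P = 'X^(k ^ n) - 'X.
  rewrite /P /per_poly rmorphB /= map_polyX; congr (_ - _).
  have f0 : horner_eval 0 ('X + 0%:P) = 0 :> C by rewrite /horner_eval !hornerE.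
  elim: (n) => [|j IHj]; first by rewrite expn0 expr1 map_polyX.
  by rewrite iter_polyS rmorphD rmorphXn /= IHj map_polyC /= f0 addr0 -exprM expnSr.
have : horner_eval (0 : C) (resultant P P^`()) != 0; last first.
  by apply: contraNneq => ->; rewrite rmorph0.
rewrite map_resultant ?lead' ?(monicP monP) ?rmorph1 ?oner_neq0 //; last first.
  by rewrite /= rmorph_nat pnatr_eq0 -lt0n ltnW.
rewrite -deriv_map ev0 resultant_eq0 -leqNgt.
suff /eqP-> : coprimep ('X^(k ^ n) - 'X : {poly C}) ('X^(k ^ n) - 'X)^`() by [].
apply: Pdiv.ClosedField.root_coprimep => x.
rewrite /root !derivE !hornerE subr_eq0 hornerMn hornerXn => /eqP xK.
apply/eqP => dx; have {}dx : x ^+ (k ^ n).-1 *+ (k ^ n) = 1 by apply/subr0_eq.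
have x0 : x = 0.
  apply/eqP; have := congr1 (fun y => x * y) dx.
  rewrite mulrnAr -exprS prednK ?(ltnW K_gt1) // xK mulr1 => /eqP.
  rewrite -{2}[x]mulr1n -subr_eq0 -mulrnBr ?(ltnW K_gt1) // mulrn_eq0.
  by rewrite subn_eq0 leqNgt K_gt1.
have K1 : ((k ^ n).-1 == 0)%N = false by rewrite -subn1 subn_eq0 leqNgt K_gt1.
by move/eqP: dx; rewrite x0 expr0n K1 mul0rn eq_sym oner_eq0.
Qed.

End PeriodicPolynomials.

(** * Rings unramified away from given places *)

Section GeneratedRing.

Variable L : comNzRingType.

Inductive generated (S : L -> Prop) : L -> Prop :=
| generated_in x : S x -> generated S x
| generated_add x y : generated S x -> generated S y -> generated S (x + y)
| generated_mul x y : generated S x -> generated S y -> generated S (x * y).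

Lemma generated_der (S : L -> Prop) (D : L -> L) :
  derivation D -> (forall x, S x -> generated S (D x)) ->
  forall z, generated S z -> generated S (D z).
Proof.
move=> der_D DS z; elim=> {z} [x /DS //|x y _ Dx _ Dy|x y gx Dx gy Dy].
  by rewrite derivationD //; apply: generated_add.
by rewrite derivationM //; apply: generated_add; apply: generated_mul.
Qed.

Lemma generated_horner (S : L -> Prop) (R : comNzRingType) (f : {rmorphism R -> L})
    (p : {poly R}) x :
  (forall a, S (f a)) -> generated S x -> generated S (map_poly f p).[x].
Proof.
move=> Sf gx; elim/poly_ind: p => [|p a IHp].
  by rewrite map_poly0 horner0 -(rmorph0 f); apply/generated_in/Sf.
rewrite rmorphD rmorphM /= map_polyX map_polyC !hornerE.
by apply: generated_add; [apply: generated_mul | apply/generated_in/Sf].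
Qed.

End GeneratedRing.

Section PeriodicRing.

Variables (C : numClosedFieldType) (L : fieldType).
Variable io : {rmorphism {poly C} -> L}.
Hypothesis io_inj : injective io.
Variables (k N : nat).
Hypotheses (k_gt1 : (1 < k)%N) (N_gt0 : (0 < N)%N).
Variables (d : {poly C}) (u v : {poly {poly C}}).
Hypothesis nz_d : d != 0.
Hypothesis bezout : u * per_poly k 0 N + v * (per_poly k 0 N)^`() = d%:P.
Variables (I : finType) (a : I -> C).

Definition shift_disc (i : I) := d \Po ('X + (a i)%:P).

(** The ring generated by these elements is etale over C[c], away from the zeros of
    the d(c + a_j) for j in J. *)
Definition periodic_gen (J : pred I) (x : L) :=
  [\/ exists p, x = io p, exists2 j, J j & x = (io (shift_disc j))^-1
    | exists2 j, J j & periodic io k (a j) N x].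

Lemma shift_disc_neq0 i : shift_disc i != 0.
Proof. by rewrite comp_poly2_eq0 // size_XaddC. Qed.

Lemma io_shift_disc_neq0 i : io (shift_disc i) != 0.
Proof. by rewrite io_eq0 ?shift_disc_neq0. Qed.

Lemma bezout_shift i : exists ui vi,
  ui * per_poly k (a i) N + vi * (per_poly k (a i) N)^`() = (shift_disc i)%:P.
Proof.
pose s := map_poly (comp_poly ('X + (a i)%:P)).
exists (s u), (s v); rewrite per_poly_shift -/s.
rewrite -[(shift_disc i)%:P](map_polyC (comp_poly ('X + (a i)%:P))) -bezout.
by rewrite /= rmorphD !rmorphM /= deriv_map.
Qed.

Lemma generated_integral (J : pred I) z : generated (periodic_gen J) z ->
  exists n, integralOver io (io ((\prod_(j | J j) shift_disc j) ^+ n) * z).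
Proof.
set g := \prod_(j | J j) _.
have int_io p : integralOver io (io p) := integral_id io p.
elim=> {z} [x [[p ->]|[j Jj ->]|[j Jj /root_per_poly rx]] | x y _ [m int_x] _ [n int_y] | x y _ [m int_x] _ [n int_y]].
- by exists 0%N; rewrite -rmorphM.
- exists 1%N; rewrite expr1 /g (bigD1 j) //= mulrC rmorphM mulKf //.
  exact: io_shift_disc_neq0.
- exists 0%N; rewrite rmorph1 mul1r; exists (per_poly k (a j) N) => //.
  exact: monic_per_poly.
- exists (m + n)%N; rewrite exprD mulrDr; apply: integral_add.
    by rewrite mulrC rmorphM mulrA [x * _]mulrC; apply: integral_mul.
  by rewrite rmorphM -mulrA; apply: integral_mul.
exists (m + n)%N; rewrite exprD rmorphM mulrACA; exact: integral_mul.
Qed.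

Variable D : L -> L.
Hypothesis der_D : derivation D.
Hypothesis D_io : forall p, D (io p) = io p^`().

(** For a root x of P one has D x = - P^D(x) / P'(x), where P^D is P with its
    coefficients differentiated, and the Bezout identity at x reads
    v(x) P'(x) = d(c + a_j). *)
Lemma periodic_gen_der (J : pred I) z :
  generated (periodic_gen J) z -> generated (periodic_gen J) (D z).
Proof.
have gen_io p : generated (periodic_gen J) (io p).
  by apply/generated_in/Or31; exists p.
have gen_opp x : generated (periodic_gen J) x -> generated (periodic_gen J) (- x).
  by move=> gx; rewrite -mulN1r -(rmorphN1 io); apply: generated_mul.
have gen_V j : J j -> generated (periodic_gen J) (io (shift_disc j))^-1.
  by move=> Jj; apply/generated_in/Or32; exists j.
apply: generated_der => // x [[p ->]|[j Jj ->]|[j Jj per_x]].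
- by rewrite D_io; apply: gen_io.
- rewrite derivationV // D_io; apply: generated_mul (gen_io _).
  by apply: gen_opp; rewrite -exprVn expr2; apply: generated_mul; apply: gen_V.
have rx := rootP (iffRL (root_per_poly _ _ _ _ _) per_x).
have [uj [vj bezout_j]] := bezout_shift j.
set P := per_poly k (a j) N in rx bezout_j.
have gen_x : generated (periodic_gen J) x by apply/generated_in/Or33; exists j.
have gen_ev (q : {poly {poly C}}) : generated (periodic_gen J) (map_poly io q).[x].
  by apply: generated_horner => // p; apply/Or31; exists p.
have der_deriv : derivation (@deriv C).
  by split=> [p q|p q]; rewrite ?derivD ?derivM.
have := derivation_horner P x der_deriv der_D D_io.
rewrite rx derivation0 // => /esym/eqP; rewrite addrC addr_eq0 => /eqP PDx.
have vP : (map_poly io vj).[x] * (map_poly io P)^`().[x] = io (shift_disc j).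
  have := congr1 (fun p => (map_poly io p).[x]) bezout_j.
  by rewrite rmorphD !rmorphM /= map_polyC hornerD !hornerM rx mulr0 add0r hornerC deriv_map.
have -> : D x = (io (shift_disc j))^-1 *
    ((map_poly io vj).[x] * - (map_poly io (map_poly (@deriv C) P)).[x]).
  apply: (@mulfI _ (io (shift_disc j))); first exact: io_shift_disc_neq0.
  by rewrite mulVKf ?io_shift_disc_neq0 // -PDx mulrA vP.
by apply: generated_mul (gen_V _ Jj) _; apply: generated_mul => //; apply: gen_opp.
Qed.

End PeriodicRing.

(** * Finite extensions of the field of rational functions *)

Section RationalFunctions.

Variable C : numClosedFieldType.

Lemma deriv_eq0_const (p : {poly C}) : p^`() = 0 -> p = (p`_0)%:P.
Proof.
move=> dp; apply/polyP => -[|i]; rewrite coefC //=.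
by have /eqP := congr1 (fun q : {poly C} => q`_i) dp; rewrite coef_deriv coef0 mulrn_eq0 => /eqP.
Qed.

Local Notation F := {fraction {poly C}}.

(** If x = a/b has derivative zero, then x b' = a' as well: descent on the degree of
    the denominator, until b' = 0. *)
Lemma frac_deriv_eq0 (dF : F -> F) x :
  derivation dF -> (forall p, dF (tofrac p) = tofrac p^`()) ->
  dF x = 0 -> exists a, x = tofrac a%:P.
Proof.
move=> der_dF dF_p dFx; have [[a b] /= nz_b Dx] := fracP x.
have {Dx} : x * tofrac b = tofrac a by rewrite Dx divfK ?tofrac_eq0.
have [n] := ubnP (size b); elim: n a b nz_b => // n IHn a b nz_b lebn Dx.
have Dx' : x * tofrac b^`() = tofrac a^`().
  by rewrite -[RHS]dF_p -Dx (derivationM der_dF) dFx mul0r add0r dF_p.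
have [db0|nz_db] := eqVneq b^`() 0; last first.
  by apply: IHn Dx' => //; rewrite (leq_trans (lt_size_deriv nz_b)).
move: Dx'; rewrite db0 tofrac0 mulr0 => /esym/eqP; rewrite tofrac_eq0 => /eqP da0.
have := deriv_eq0_const da0; move: (a`_0) => a0 Da.
have := deriv_eq0_const db0; move: (b`_0) => b0 Db.
have nz_b0 : b0 != 0 by rewrite -polyC_eq0 -Db.
exists (a0 / b0); apply: (@mulIf _ (tofrac b)); first by rewrite tofrac_eq0.
by rewrite Dx -tofracM Da Db -polyCM divfK.
Qed.

Variable L : splittingFieldType F.

Definition poly_emb : {poly C} -> L := in_alg L \o @tofrac _.
HB.instance Definition _ := GRing.RMorphism.on poly_emb.

Lemma poly_emb_inj : injective poly_emb.
Proof. by move=> p q /fmorph_inj/eqP; rewrite tofrac_eq => /eqP. Qed.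

Lemma pchar_ext : [pchar L] =i pred0.
Proof. by move=> p; rewrite (fmorph_pchar (scalar_emb poly_emb)) pchar_num. Qed.

Lemma galois_ext (K : {subfield L}) : galois K {:L}.
Proof.
rewrite /galois subvf normalFieldf andbT; apply/separableP => y _.
exact: pcharf0_separable pchar_ext _.
Qed.

Lemma poly_emb_frac x : x \in 1%VS ->
  exists2 ab : {poly C} * {poly C}, ab.2 != 0 & poly_emb ab.2 * x = poly_emb ab.1.
Proof.
case/vlineP=> y ->; have [[a b] /= nz_b ->] := fracP y; exists (a, b) => //=.
rewrite /poly_emb /= -[_ *: 1]/(in_alg L _) -rmorphM /=; congr (_ *: _).
by rewrite mulrC divfK // tofrac_eq0.
Qed.

Lemma mem_poly_emb p : poly_emb p \in 1%VS.
Proof. by apply/vlineP; exists (tofrac p). Qed.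

Lemma conjugates_exist (z : L) : has_conjugates poly_emb z.
Proof.
pose G := 'Gal({:L} / 1)%G; have galL := galois_ext 1%AS.
pose s (j : 'I_#|G|) : {rmorphism L -> L} := gal_repr (enum_val j).
exists #|G|, s; split.
- by move=> j p; apply: (fixed_gal (sub1v _) (enum_valP j) (mem_poly_emb p)).
- have G1 : 1%g \in G by apply: group1.
  by exists (enum_rank_in G1 1%g); rewrite /s /= enum_rankK_in // gal_id.
move=> i; apply: poly_emb_frac; set p := \prod_j _.
have <- : fixedField G = 1%VS by apply/galois_fixedField.
have Dp : p = \prod_(g in G) ('X - (gal_repr g z)%:P).
  by rewrite (big_enum_val (fun g => 'X - (gal_repr g z)%:P)).
apply/fixedFieldP; rewrite ?memvf // => x Gx.
suff Dpx : map_poly (gal_repr x) p = p by rewrite -[LHS]coef_map Dpx.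
rewrite Dp rmorph_prod [RHS](reindex_inj (mulIg x)) /=.
apply: eq_big => g; first by rewrite groupMr.
by rewrite rmorphB /= map_polyX map_polyC galM ?memvf.
Qed.

(** If D z = 0, applying D to the minimal polynomial of z at z gives an equation of
    smaller degree, so the coefficients of the minimal polynomial are constants;
    hence z is algebraic over C. *)
Lemma derivation_dc : exists D : L -> L,
  [/\ derivation D, forall p, D (poly_emb p) = poly_emb p^`()
    & forall z, D z = 0 -> exists a, z = poly_emb a%:P].
Proof.
have der_deriv : derivation (@deriv C).
  by split=> [p q|p q]; rewrite ?derivD ?derivM.
have [dF der_dF dF_p] := derivation_frac der_deriv.
have [D der_D D_F] := derivation_ext pchar_ext der_dF.
exists D; split=> // [p|z Dz]; first by rewrite /poly_emb /= D_F dF_p.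
have dF0 := derivation0 der_dF.
have /polyOver1P[p Dp] := minPolyOver 1 z.
have monp : p \is monic by rewrite -(map_monic (in_alg L)) -Dp monic_minPoly.
have dp0 : map_poly dF p = 0.
  apply/eqP; rewrite -(map_poly_eq0 (in_alg L)); apply: contraTT isT => nz_dp.
  have := derivation_horner (i := in_alg L) p z der_dF der_D D_F.
  rewrite -Dp minPolyxx derivation0 // Dz mulr0 addr0 => /esym/rootP dpz.
  have : (size (map_poly (in_alg L) (map_poly dF p)) < size (minPoly 1 z))%N.
    rewrite Dp !size_map_poly; have szp : (0 < size p)%N by rewrite size_poly_gt0 monic_neq0.
    rewrite -[X in (_ < X)%N](prednK szp) ltnS; apply/leq_sizeP => j.
    rewrite coef_map_id0 // leq_eqVlt => /predU1P[<-|].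
      by rewrite -lead_coefE (monicP monp) derivation1.
    by rewrite prednK // => lepj; rewrite nth_default.
  rewrite ltnNge dvdp_leq //; apply: minPoly_dvdp dpz.
  by apply/polyOver1P; exists (map_poly dF p).
have /choice[q Dq] i : exists a, p`_i = tofrac a%:P.
  apply: frac_deriv_eq0 dF_p _ => //.
  by rewrite -coef_map_id0 // dp0 coef0.
pose r := \poly_(i < size p) q i.
have Dr : map_poly (scalar_emb poly_emb) r = minPoly 1 z.
  rewrite Dp; apply/polyP => i; rewrite !coef_map coef_poly /= Dq.
  case: ltnP => // lepi; rewrite /scalar_emb /poly_emb /= polyC0 tofrac0.
  by rewrite -Dq nth_default.
apply: (@algebraic_scalar _ _ poly_emb r); last by rewrite Dr root_minPoly.
rewrite -(map_poly_eq0 (scalar_emb poly_emb)) Dr.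
exact/monic_neq0/monic_minPoly.
Qed.

(** The elements of rs being algebraic over C(c), the field they generate consists of
    their polynomial expressions over C(c), whose denominators only involve c. *)
Lemma adjoin_clear_denom (V : L -> Prop) (rs : seq L) :
  (forall p, V (poly_emb p)) -> {in rs, forall x, V x} ->
  (forall x y, V x -> V y -> V (x + y)) -> (forall x y, V x -> V y -> V (x * y)) ->
  forall z, z \in <<1 & rs>>%VS -> exists2 p, p != 0 & V (poly_emb p * z).
Proof.
move=> Vp Vrs VD VM; elim/last_ind: rs Vrs => [|rs x IHrs] Vrs z.
  rewrite Fadjoin_nil => /poly_emb_frac[[a b] /= nz_b Dz].
  by exists b => //; rewrite Dz.
rewrite adjoin_rcons => /Fadjoin_polyP[q Kq ->].
have {}IHrs : forall y, y \in <<1 & rs>>%VS -> exists2 p, p != 0 & V (poly_emb p * y).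
  by apply: IHrs => y rs_y; apply: Vrs; rewrite mem_rcons inE rs_y orbT.
have Vx : V x by apply: Vrs; rewrite mem_rcons mem_head.
elim/poly_ind: q Kq => [|q a IHq] Kq.
  by exists 1; rewrite ?oner_neq0 // horner0 mulr0 -(rmorph0 poly_emb).
have [Kq1 Ka] : q \is a polyOver <<1 & rs>>%VS /\ a \in <<1 & rs>>%VS.
  split; last by have := polyOverP Kq 0%N; rewrite coefD coefMX coefC add0r.
  by apply/polyOverP => i; have := polyOverP Kq i.+1; rewrite coefD coefMX coefC addr0.
have [p1 nz_p1 Vq] := IHq Kq1; have [p2 nz_p2 Va] := IHrs a Ka.
exists (p1 * p2); first by rewrite mulf_neq0.
have -> : poly_emb (p1 * p2) * (q * 'X + a%:P).[x] =
    poly_emb p2 * (poly_emb p1 * q.[x]) * x + poly_emb p1 * (poly_emb p2 * a).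
  rewrite (rmorphM poly_emb) !hornerE /=.
  by move: (poly_emb p1) (poly_emb p2) q.[x] => e1 e2 y; ring.
exact: VD (VM _ _ (VM _ _ (Vp p2) Vq) Vx) (VM _ _ (Vp p1) Va).
Qed.

(** After multiplication by a polynomial in c, an element of the intersection lies in
    both D-stable rings and has some weight. Membership in the two rings makes all
    its derivatives integral over C[c], since the denominators allowed by one ring
    are coprime to those allowed by the other. *)
Lemma periodic_fields_disjoint (k N : nat) (d : {poly C}) (u v : {poly {poly C}})
    (I : finType) (a : I -> C) (i : I) (J : pred I) (rs ss : seq L) :
  (1 < k)%N -> (0 < N)%N -> d != 0 ->
  u * per_poly k 0 N + v * (per_poly k 0 N)^`() = d%:P ->
  (forall j, J j -> coprimep (shift_disc d a i) (shift_disc d a j)) ->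
  {in rs, forall x, periodic poly_emb k (a i) N x} ->
  {in ss, forall x, exists2 j, J j & periodic poly_emb k (a j) N x} ->
  (<<1 & rs>> :&: <<1 & ss>> <= 1)%VS.
Proof.
move=> k_gt1 N_gt0 nz_d bez cop per_rs per_ss.
have io_inj := poly_emb_inj.
have [D [der_D D_io D_ker]] := derivation_dc.
pose gen (J : pred I) := generated (periodic_gen poly_emb k N d a J).
pose wt := weight poly_emb k (periodic poly_emb k (a i) N).
have gen_io J0 p : gen J0 (poly_emb p) by apply/generated_in/Or31; exists p.
pose W (r : int) z := [/\ gen (pred1 i) z, gen J z & wt r z].
have W_poly : forall (n : nat) z, W n z -> exists q, z = poly_emb q.
  apply: (integral_asymp_poly io_inj (ltnW k_gt1) der_D D_io D_ker conjugates_exist).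
  - move=> r z [gi gJ _].
    have [n int_i] := generated_integral io_inj k_gt1 N_gt0 nz_d gi.
    have [m int_J] := generated_integral io_inj k_gt1 N_gt0 nz_d gJ.
    apply: integral_coprime int_i int_J.
    rewrite big_pred1_eq; apply/coprimep_expl/coprimep_expr.
    elim/big_ind: _ => [|p q cop_p cop_q|j Jj]; first exact: coprimep1.
      by rewrite coprimepMr cop_p.
    exact: cop.
  - move=> r z [_ _ wz]; apply: weight_asymp wz => // x per_x.
    exact: periodic_asymp per_x.
  move=> r z [gi gJ wz]; split.
  - exact: (periodic_gen_der io_inj nz_d bez der_D D_io gi).
  - exact: (periodic_gen_der io_inj nz_d bez der_D D_io gJ).
  apply: (@weight_mono _ _ _ _ _ (r - k%:Z)); first by lia.
  apply: weight_der => // x per_x; exact: periodic_weight_der.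
apply/subvP => z; rewrite memv_cap => /andP[Kz K'z].
have [|x rs_x|x y|x y||p nz_p [gp [n wp]]] :=
  @adjoin_clear_denom (fun z => gen (pred1 i) z /\ exists n : nat, wt n z) rs _ _ _ _ z.
- move=> p; split; first exact: gen_io.
  exact: weight_poly.
- split; first by apply/generated_in/Or33; exists i; [apply: eqxx | apply: per_rs].
  by exists 1%N; apply/weight_gen/per_rs.
- move=> [gx [m wx]] [gy [n wy]]; split; first exact: generated_add.
  exists (m + n)%N; apply: weight_add; [apply: weight_mono wx | apply: weight_mono wy]; lia.
- move=> [gx [m wx]] [gy [n wy]]; split; first exact: generated_mul.
  by exists (m + n)%N; rewrite PoszD; apply: weight_mul.
- by [].
have [|x ss_x|x y gx gy|x y gx gy||q nz_q gq] := @adjoin_clear_denom (gen J) ss _ _ _ _ z.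
- exact: gen_io.
- by have [j Jj per_x] := per_ss x ss_x; apply/generated_in/Or33; exists j.
- exact: generated_add.
- exact: generated_mul.
- by [].
have [m wq] := weight_poly poly_emb k (periodic poly_emb k (a i) N) q.
have [|e De] := W_poly (m + n)%N (poly_emb q * (poly_emb p * z)).
  split; first exact: generated_mul (gen_io _ q) gp.
    by rewrite mulrCA; exact: generated_mul (gen_io J p) gq.
  by rewrite PoszD; apply: weight_mul.
have nz x : x != 0 -> poly_emb x != 0 by rewrite -(rmorph0 poly_emb) (inj_eq io_inj).
have -> : z = (poly_emb q)^-1 * ((poly_emb p)^-1 * poly_emb e).
  by rewrite -De mulrCA mulKf ?mulKf ?nz.
by rewrite !(rpredM, rpredV) ?mem_poly_emb.
Qed.

End RationalFunctions.

(** * Galois groups of composita *)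

Section DirectProduct.

Local Open Scope group_scope.

(** The product is generated by the elements with one nontrivial coordinate. *)
Lemma isog_setXn_coords (I : finType) (gT : I -> finGroupType) (aT : finGroupType)
    (G : {group aT}) (phi : forall i, {morphism G >-> gT i}) :
  (forall x, x \in G -> (forall i, phi i x = 1) -> x = 1) ->
  (forall i h, h \in phi i @* G ->
     exists x, [/\ x \in G, phi i x = h & forall j, j != i -> phi j x = 1]) ->
  G \isog setXn (fun i => phi i @* G).
Proof.
move=> phi_inj phi_lift.
pose f x : {dffun forall i, gT i} := [ffun i => phi i x].
have fM : {in G &, {morph f : x y / x * y}}.
  by move=> x y Gx Gy; apply/ffunP => i; rewrite !ffunE morphM.
apply/isogP; exists (Morphism fM).
  apply/fintype.subsetP => x /morphpreP[Gx /set1P fx1].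
  apply/set1P/phi_inj => // i.
  by move/ffunP/(_ i): fx1; rewrite !ffunE.
apply/eqP; rewrite finset.eqEsubset; apply/andP; split.
  apply/fintype.subsetP => _ /morphimP[x Gx _ ->]; apply/setXnP => i.
  by rewrite ffunE mem_morphim.
rewrite /= -(setXn_prod (fun i => (phi i @* G)%G)) prod_subG // => i _.
apply/fintype.subsetP => _ /set1gXnP[h /phi_lift[x [Gx phix phi1]] ->].
apply/morphimP; exists x => //; apply/ffunP => j /=; rewrite !ffunE.
by case: dfwithP => [|j' neq]; rewrite ?phix // phi1 // eq_sym.
Qed.

(** The fixed field of the join of Gal(E/K_i) and Gal(E/K'_i) is contained in the
    intersection of K_i and K'_i, so these two groups generate Gal(E/F). As the first
    one is trivial on K_i, every automorphism of K_i is induced by an element of the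
    second one, which is trivial on the other K_j. *)
Lemma isog_gal_setXn (F : fieldType) (L : splittingFieldType F) (I : finType)
    (K K' : I -> {subfield L}) (E : {subfield L}) :
  galois 1 E -> (forall i, normalField 1 (K i)) -> (forall i, K i <= E)%VS ->
  (forall i, K' i <= E)%VS ->
  (forall i j, j != i -> K j <= K' i)%VS ->
  (forall i, K i :&: K' i <= 1)%VS ->
  (forall B : {subfield L}, (forall i, K i <= B)%VS -> (E <= B)%VS) ->
  'Gal(E / 1) \isog setXn (fun i => 'Gal(K i / 1)).
Proof.
move=> galE nK sKE sK'E sKK' disj genE.
have sK i : (1%AS <= K i <= E)%VS by rewrite sub1v sKE.
pose phi i := normalField_cast_morphism (K := 1%AS) (sK i) (nK i).
have imphi i : phi i @* 'Gal(E / 1) = 'Gal(K i / 1) := normalField_img galE (sK i) (nK i).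
have phiE i x : x \in 'Gal(E / 1) -> {in K i, phi i x =1 x}.
  by move=> Gx; apply: normalField_cast_eq.
have phi1 i x : x \in 'Gal(E / 1) -> x \in 'Gal(E / K i) -> phi i x = 1.
  move=> Gx Kx; apply/eqP/gal_eqP => z Kz.
  by rewrite (phiE i) // gal_id (fixed_gal (sKE i) Kx).
rewrite (eq_setXn (B := fun i => phi i @* 'Gal(E / 1))) //.
apply: (isog_setXn_coords (G := 'Gal(E / 1)%G)) => [x Gx phix1 | i h].
  apply/eqP/gal_eqP => z Ez; rewrite gal_id.
  suff /subvP/(_ z Ez) : (E <= fixedField [set x])%VS.
    by case/mem_fixedFieldP => _; apply; rewrite inE.
  apply: genE => j; apply/subvP => y Ky.
  apply/fixedFieldP => [|_ /set1P->]; first exact: (subvP (sKE j)).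
  by rewrite -(phiE j) // phix1 gal_id.
case/morphimP=> g Gg _ ->.
have nsN : 'Gal(E / K i) <| 'Gal(E / 1) := normalField_normal (sK i) (nK i).
have sHG : 'Gal(E / K' i) \subset 'Gal(E / 1) by apply/galS/sub1v.
have galK : galois (K i) E by apply: galoisS galE; rewrite sub1v sKE.
have galK' : galois (K' i) E by apply: galoisS galE; rewrite sub1v sK'E.
pose NH := ('Gal(E / K i) <*> 'Gal(E / K' i))%G.
have sGNH : 'Gal(E / 1) \subset NH.
  have <- : 'Gal(E / fixedField NH) = NH := gal_fixedField NH.
  apply: galS.
  apply: subv_trans (disj i); rewrite subv_cap.
  rewrite -{1}(galois_fixedField galK).
  rewrite -(galois_fixedField galK').
  by rewrite !fixedFieldS ?joing_subl ?joing_subr.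
have : g \in NH := fintype.subsetP sGNH g Gg.
rewrite /= norm_joinEr; last exact: fintype.subset_trans sHG (normal_norm nsN).
case/mulsgP=> n x Nn Hx Dg; have Gx : x \in 'Gal(E / 1) := fintype.subsetP sHG x Hx.
have Gn : n \in 'Gal(E / 1) := fintype.subsetP (normal_sub nsN) n Nn.
exists x; split=> // [|j neq_ji]; first by rewrite Dg (morphM (phi i)) // (phi1 i n) ?mul1g.
by apply: phi1 => //; apply: fintype.subsetP (galS _ (sKK' i j neq_ji)) x Hx.
Qed.

End DirectProduct.

(** * Choice of the translations *)

(** Two translates have a common zero only if the translations differ by a
    difference of zeros of d, and these are bounded. *)
Lemma coprime_translates (d : {poly algC}) : d != 0 ->
  exists B : nat, forall s t : int, (B <= `|s - t|)%N ->
    coprimep (d \Po ('X + (s%:~R)%:P)) (d \Po ('X + (t%:~R)%:P)).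
Proof.
move=> nz_d; have [rs Dd] := closed_field_poly_normal d.
have mem_rs z : root d z = (z \in rs).
  by rewrite {1}Dd rootZ ?lead_coef_eq0 // root_prod_XsubC.
pose b := \sum_(x <- rs) \sum_(y <- rs) `|x - y|.
have b_ge0 : 0 <= b by apply: sumr_ge0 => x _; apply: sumr_ge0 => y _.
exists (Num.bound b) => s t leB; apply: Pdiv.ClosedField.root_coprimep => z.
rewrite /root !horner_comp !hornerE -!/(root d _) !mem_rs => rs_s.
apply/negP => rs_t.
have le_b : `|(s - t)%:~R| <= b :> algC.
  have -> : (s - t)%:~R = (z + s%:~R) - (z + t%:~R) :> algC by rewrite rmorphB /=; ring.
  rewrite /b (big_rem _ rs_s) /= (big_rem _ rs_t) /= -[leRHS]addrA lerDl addr_ge0 //.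
    by apply: sumr_ge0.
  by apply: sumr_ge0 => x _; apply: sumr_ge0.
have le_B : (Num.bound b)%:R <= `|(s - t)%:~R| :> algC.
  by rewrite -intr_norm -[leLHS]/((Num.bound b)%:~R) ler_int -abszE lez_nat.
by have := le_lt_trans (le_trans le_B le_b) (archi_boundP b_ge0); rewrite ltxx.
Qed.

Lemma gal_direct_product_of_coprime (k M N : nat) (d : {poly algC})
    (u v : {poly {poly algC}}) (m : M.-tuple int) :
  (1 < k)%N -> (0 < N)%N -> d != 0 ->
  u * per_poly k 0 N + v * (per_poly k 0 N)^`() = d%:P ->
  let a i := (tnth m i)%:~R in
  (forall i j : 'I_M, j != i -> coprimep (shift_disc d a i) (shift_disc d a j)) ->
  gal_is_direct_product k N m.
Proof.
move=> k_gt1 N_gt0 nz_d bez a cop p L K E splitK splitE.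
have gE i : cvar + (tnth m i)%:~R = tofrac ('X + (a i)%:P).
  by rewrite tofracD /a (rmorph_int polyC) (rmorph_int (@tofrac _)).
have mapp i : map_poly (in_alg L) (p i) =
    map_poly (poly_emb L) (per_poly k (a i) N).
  rewrite /poly_emb map_poly_comp; congr (map_poly _ _).
  rewrite /per_poly rmorphB /= map_polyX (map_iter_poly k (@tofrac _)) /= -gE.
  by [].
have periodicP i x : root (map_poly (in_alg L) (p i)) x <->
    periodic (poly_emb L) k (a i) N x by rewrite mapp; apply: root_per_poly.
have root_zs (q : {poly L}) (rs : seq L) x :
    q %= \prod_(r <- rs) ('X - r%:P) -> root q x = (x \in rs).
  by move/eqp_root=> ->; rewrite root_prod_XsubC.
have /choice[zs Dzs] : forall i, exists rs : seq L,
    [/\ forall x, (x \in rs) <-> periodic (poly_emb L) k (a i) N x,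
        (<<1 & rs>>%VS = K i) & normalField 1 (K i)].
  move=> i; have [rs Drs defK] := splitK i.
  exists rs; split=> //; first by move=> x; rewrite -(root_zs _ _ x Drs); apply: periodicP.
  apply/splitting_normalField; first exact: sub1v.
  exists (map_poly (in_alg L) (p i)); first by apply/polyOver1P; exists (p i).
  by exists rs.
have [es Des defE] := splitE.
have mem_es x : (x \in es) = [exists i, x \in zs i].
  rewrite -(root_zs _ _ x Des) rmorph_prod /root horner_prod prodf_seq_eq0.
  apply/hasP/existsP => [[i _ /= pix]|[i zi_x]].
    by exists i; apply/(let: And3 H _ _ := Dzs i in H); apply/periodicP.
  exists i; first by rewrite mem_index_enum.
  by apply/periodicP; case: (Dzs i) => <-.
have sKE i : (K i <= E)%VS.
  have [_ <- _] := Dzs i; apply/Fadjoin_seqP; split=> [|x zi_x]; first exact: sub1v.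
  by rewrite -defE seqv_sub_adjoin // mem_es; apply/existsP; exists i.
have normE : normalField 1 E.
  apply/splitting_normalField; first exact: sub1v.
  exists (map_poly (in_alg L) (\prod_i p i)); last by exists es.
  by apply/polyOver1P; exists (\prod_i p i).
have galE : galois 1 E.
  rewrite /galois sub1v normE andbT; apply/separableP => y _.
  exact: pcharf0_separable (pchar_ext L) _.
(* the generators of the compositum of the K_j with j != i *)
pose others i := flatten [seq zs j | j <- enum (predC1 i)].
have othersP i x : reflect (exists2 j, j != i & x \in zs j) (x \in others i).
  apply: (iffP flatten_mapP) => -[j]; rewrite ?mem_enum => neq_ji zj_x.
    by exists j.
  by exists j; rewrite ?mem_enum.
apply: (isog_gal_setXn (K' := fun i => <<1 & others i>>%AS)) => //.
- by move=> i; case: (Dzs i).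
- move=> i; apply/Fadjoin_seqP; split=> [|x /othersP[j _ zj_x]]; first exact: sub1v.
  by rewrite -defE seqv_sub_adjoin // mem_es; apply/existsP; exists j.
- move=> i j neq_ji; have [_ <- _] := Dzs j.
  by apply: adjoin_seqSr => x zj_x; apply/othersP; exists j.
- move=> i; have [perP <- _] := Dzs i.
  apply: (periodic_fields_disjoint (J := predC1 i) k_gt1 N_gt0 nz_d bez) => [j||x].
  + exact: cop.
  + by move=> x; rewrite perP.
  by case/othersP=> j neq_ji; case: (Dzs j) => perPj _ _ /perPj; exists j.
move=> B sKB; rewrite -defE; apply/Fadjoin_seqP; split=> [|x]; first exact: sub1v.
rewrite mem_es => /existsP[i zi_x]; apply: (subvP (sKB i)).
by have [_ <- _] := Dzs i; apply: seqv_sub_adjoin.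
Qed.

Theorem theorem2p3 (k M N : nat) (k_ge2 : (2 <= k)%N)
    (M_gt0 : (0 < M)%N) (N_gt0 : (0 < N)%N) :
  infinite_set [set m : M.-tuple int | gal_is_direct_product k N m]%classic.
Proof.
have [d nz_d [u [v bez]]] := per_poly_bezout algC k_ge2 N_gt0.
have [B copB] := coprime_translates nz_d.
(* the entries of each tuple are at distance at least B from each other, and j moves
   the tuple without changing the distances *)
pose m (j : nat) : M.-tuple int := [tuple (j + B * i)%:Z | i < M].
have m_ok j : gal_is_direct_product k N (m j).
  apply: gal_direct_product_of_coprime bez _ => // i1 i2 neq_i.
  apply: copB; rewrite !tnth_mktuple !PoszD opprD addrACA subrr add0r.
  rewrite !PoszM -mulrBr abszM leq_pmulr // absz_gt0 subr_eq0.
  by rewrite eqz_nat eq_sym.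
have m_inj : injective m.
  move=> j1 j2 /(congr1 (fun t => tnth t (Ordinal M_gt0))).
  by rewrite !tnth_mktuple muln0 !addn0 => -[].
move=> fin_m; apply: infinite_nat.
suff -> : [set: nat]%classic = (m @^-1` [set m | gal_is_direct_product k N m])%classic.
  by apply: finite_preimage => // j1 j2 _ _ /m_inj.
by apply/seteqP; split=> // j _; apply: m_ok.
Qed.
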